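(* Consider online preemptive weighted throughput maximization on $m$ unrelated machines, where every job has slack $\varepsilon>0$ (defined in the context), and where schedules are required to be non-migratory. There exist an online algorithm and an absolute constant $C>0$ such that for every $\varepsilon>0$ and every instance with slack $\varepsilon$, the algorithm produces a feasible non-migratory schedule whose total weight of jobs completed by their deadlines is at least $\frac{1}{C\max\{1,1/\varepsilon\}}$ times the maximum total weight of jobs completed by their deadlines in any feasible non-migratory schedule of that instance. In other words, the algorithm is $\mathcal{O}\big(\frac1\varepsilon\big)$-competitive.
   Context: There are $m$ machines. Jobs arrive online over time: job $j$ is revealed at its release date $r_j$, together with its processing times $p_{ij}\in\mathbb{R}_{>0}\cup\{\infty\}$ on each machine $i\in\{1,\dots,m\}$, its weight $w_j> 0$, and its deadline $d_j$; the online algorithm has no information about a job before its release. Machine $i$ is eligible for $j$ if $p_{ij}<\infty$. Preemption is allowed: processing of a job may be interrupted and resumed later. In a non-migratory schedule each job is processed on at most one machine, and a job processed on machine $i$ completes once it has received $p_{ij}$ units of processing on $i$. In a feasible schedule each machine processes at most one job at a time, each job is processed by at most one machine at a time, and no job is processed before its release date. The objective (weighted throughput) is the total weight of jobs that complete by their deadlines. Slack assumption with parameter $\varepsilon>0$: for every job $j$ and every eligible machine $i$, $d_j-r_j\ge(1+\varepsilon)p_{ij}$. *)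

(* Defs.v *)
From Stdlib Require Import Reals Lra List Bool.
Import ListNotations.
Open Scope R_scope.

(* A job: identifier, release date, deadline, weight, and processing times.
   [ptime i = Some p] means p_{ij} = p < oo (machine i eligible);
   [ptime i = None] means p_{ij} = oo.  Machines are 0 .. m-1. *)
Record job := Job {
  jid   : nat;
  rel   : R;
  dl    : R;
  wt    : R;
  ptime : nat -> option R
}.

Definition instance := list job.

Definition valid_instance (I : instance) : Prop :=
  NoDup (map jid I) /\
  (forall j, In j I -> 0 < wt j) /\
  (forall j i x, In j I -> ptime j i = Some x -> 0 < x).

Definition has_slack (m : nat) (eps : R) (I : instance) : Prop :=
  forall j i x, In j I -> (i < m)%nat -> ptime j i = Some x ->
    (1 + eps) * x <= dl j - rel j.

(* A preemptive schedule: a finite list of processing segments;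
   [Seg i k s e] = machine i processes the job with identifier k
   during the time interval [s, e). *)
Record segment := Seg { smach : nat; sjob : nat; sstart : R; send : R }.
Definition schedule := list segment.

Definition job_of (I : instance) (k : nat) (j : job) : Prop := In j I /\ jid j = k.

Definition disjoint_seg (a b : segment) : Prop :=
  send a <= sstart b \/ send b <= sstart a.

Definition feasible_nm (m : nat) (I : instance) (S : schedule) : Prop :=
  (forall a, In a S ->
     (smach a < m)%nat /\ sstart a < send a /\
     exists j, job_of I (sjob a) j /\ rel j <= sstart a) /\
  (forall k1 k2, (k1 < length S)%nat -> (k2 < length S)%nat -> k1 <> k2 ->
     let a := nth k1 S (Seg 0 0 0 0) in let b := nth k2 S (Seg 0 0 0 0) in
     smach a = smach b -> disjoint_seg a b) /\
  (forall k1 k2, (k1 < length S)%nat -> (k2 < length S)%nat -> k1 <> k2 ->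
     let a := nth k1 S (Seg 0 0 0 0) in let b := nth k2 S (Seg 0 0 0 0) in
     sjob a = sjob b -> disjoint_seg a b) /\
  (forall a b, In a S -> In b S -> sjob a = sjob b -> smach a = smach b).

Definition proc_by_deadline (S : schedule) (j : job) (i : nat) : R :=
  fold_right (fun a acc =>
    if andb (Nat.eqb (smach a) i) (Nat.eqb (sjob a) (jid j))
    then Rmax 0 (Rmin (send a) (dl j) - Rmax (sstart a) (rel j)) + acc
    else acc) 0 S.

Definition completes (m : nat) (S : schedule) (j : job) : bool :=
  existsb (fun i => match ptime j i with
                    | Some x => if Rle_dec x (proc_by_deadline S j i) then true else false
                    | None => false
                    end) (seq 0 m).

Definition throughput (m : nat) (I : instance) (S : schedule) : R :=
  fold_right (fun j acc => (if completes m S j then wt j else 0) + acc) 0 I.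

Definition processes (S : schedule) (i k : nat) (t : R) : Prop :=
  exists a, In a S /\ smach a = i /\ sjob a = k /\ sstart a <= t < send a.

Definition algorithm := nat -> instance -> schedule.

Definition online (A : algorithm) : Prop :=
  forall m I I' t, valid_instance I -> valid_instance I' ->
    (forall j, (In j I /\ rel j <= t) <-> (In j I' /\ rel j <= t)) ->
    forall i k, processes (A m I) i k t <-> processes (A m I') i k t.

(* Main.v *)
(** For a job of size [p] on a machine put [s = min(d - r - p, p) / 2].  A job admitted on a
    machine at time [x <= d - p - s] meets its deadline as soon as the jobs admitted later on
    that machine during the fixed interval [L = [x, x + p + s)] have total size at most [s],
    provided that later admissions have priority.  At every time the algorithm admits a
    waiting job [j] on a machine [i] if [w_j] is at least twice the sum of
    [w_a min(1, p_j / s_a)] over the jobs [a] of [i] whose interval contains that time.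
    A job [a] that is not guaranteed to finish has been charged at least [w_a] by later jobs,
    and exchanging the order of summation shows that the guaranteed jobs carry at least half
    of the admitted weight.

    A job [j] that is never admitted violates the admission rule on every machine throughout
    [[r, d - p - s]].  Averaging this over a window of length [s_j] within distance [2 p_j] of
    a time [tau] in [[r, d]] bounds the density [w_j / p_j] by [O(max(1, 1/eps))] times
    the sum of [w_a p_a / (p_a^2 + (tau - x_a)^2)].  This is the derivative of
    [sum_a w_a atan((tau - x_a) / p_a)], so integrating along the segments of any other
    schedule bounds the weight it gains from such jobs by [O(max(1, 1/eps))] times the
    admitted weight. *)

Require Import Defs.
From Stdlib Require Import Reals Lra Lia List Bool Arith.
From Stdlib Require Import Classical ClassicalEpsilon FunctionalExtensionality PropExtensionality.
Import ListNotations.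
Open Scope R_scope.

(** * Finite sums *)

Definition sumR {T} (f : T -> R) (l : list T) : R :=
  fold_right (fun x acc => f x + acc) 0 l.

Lemma sumR_app {T} (f : T -> R) l1 l2 : sumR f (l1 ++ l2) = sumR f l1 + sumR f l2.
Proof. induction l1 as [|x l1 IH]; simpl; [lra|]. rewrite IH. lra. Qed.

Lemma sumR_le {T} (f g : T -> R) l :
  (forall x, In x l -> f x <= g x) -> sumR f l <= sumR g l.
Proof.
  induction l as [|x l IH]; intros H; simpl; [lra|].
  assert (f x <= g x) by (apply H; now left).
  assert (sumR f l <= sumR g l) by (apply IH; intros; apply H; now right). lra.
Qed.

Lemma sumR_ext {T} (f g : T -> R) l :
  (forall x, In x l -> f x = g x) -> sumR f l = sumR g l.
Proof. intros H. apply Rle_antisym; apply sumR_le; intros x Hx; rewrite (H x Hx); lra. Qed.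

Lemma sumR_scal {T} (f : T -> R) c l : sumR (fun x => c * f x) l = c * sumR f l.
Proof. induction l as [|x l IH]; simpl; [lra|]. rewrite IH. lra. Qed.

Lemma sumR_plus {T} (f g : T -> R) l : sumR (fun x => f x + g x) l = sumR f l + sumR g l.
Proof. induction l as [|x l IH]; simpl; [lra|]. rewrite IH. lra. Qed.

Lemma sumR_nonneg {T} (f : T -> R) l : (forall x, In x l -> 0 <= f x) -> 0 <= sumR f l.
Proof.
  intros H. replace 0 with (sumR (fun _ : T => 0) l).
  - now apply sumR_le.
  - induction l as [|x l IH]; simpl; [lra|]. rewrite IH; [lra|]. intros; apply H; now right.
Qed.

Lemma sumR_swap {T U} (f : T -> U -> R) l k :
  sumR (fun x => sumR (f x) k) l = sumR (fun y => sumR (fun x => f x y) l) k.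
Proof.
  induction l as [|x l IH]; simpl.
  - induction k as [|y k IHk]; simpl; [lra|]. rewrite <- IHk. lra.
  - rewrite IH, <- sumR_plus. reflexivity.
Qed.

Lemma sumR_map {T U} (g : T -> U) (f : U -> R) l : sumR f (map g l) = sumR (fun x => f (g x)) l.
Proof. induction l as [|x l IH]; simpl; [lra|]. now rewrite IH. Qed.

Lemma sumR_filter {T} (b : T -> bool) (f : T -> R) l :
  sumR (fun x => if b x then f x else 0) l = sumR f (filter b l).
Proof. induction l as [|x l IH]; simpl; [lra|]. destruct (b x); simpl; rewrite IH; lra. Qed.

Lemma sumR_incl {T} (f : T -> R) l k :
  NoDup l -> incl l k -> (forall x, In x k -> 0 <= f x) -> sumR f l <= sumR f k.
Proof.
  intros Hnd; revert k; induction Hnd as [|x l Hx Hnd IH]; intros k Hi Hf; simpl.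
  - now apply sumR_nonneg.
  - destruct (in_split x k) as [k1 [k2 ->]]; [apply Hi; now left|].
    assert (sumR f l <= sumR f (k1 ++ k2)).
    { apply IH.
      - intros y Hy. assert (In y (k1 ++ x :: k2)) as H by (apply Hi; now right).
        apply in_app_iff in H. apply in_app_iff. destruct H as [H|[H|H]]; auto. now subst.
      - intros y Hy. apply Hf. apply in_app_iff in Hy. apply in_app_iff. simpl. tauto. }
    rewrite sumR_app in *. simpl. lra.
Qed.

(** Serves twice: with [Ropp] it finds the latest breakpoint not after a given time, with the
    identity the earliest admissible one. *)
Lemma arg_min {T} (f : T -> R) (P : T -> Prop) l :
  (exists x, In x l /\ P x) ->
  exists x, In x l /\ P x /\ forall y, In y l -> P y -> f x <= f y.
Proof.
  induction l as [|z l IH]; intros [x [Hx HP]]; [easy|].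
  destruct (classic (exists x, In x l /\ P x)) as [He|Hn].
  - destruct (IH He) as [x0 [H1 [H2 H3]]].
    destruct (classic (P z /\ f z <= f x0)) as [[Hz Hle]|Hz].
    + exists z. split; [now left|]. split; [easy|].
      intros y [->|Hy] Py; [lra|]. specialize (H3 y Hy Py). lra.
    + exists x0. split; [now right|]. split; [easy|].
      intros y [->|Hy] Py; [|now apply H3].
      apply Rnot_lt_le. intros Hlt. apply Hz. split; [easy|lra].
  - exists z. destruct Hx as [->|Hx]; [|exfalso; apply Hn; eauto].
    split; [now left|]. split; [easy|].
    intros y [->|Hy] Py; [lra|]. exfalso; apply Hn; eauto.
Qed.

(** * The algorithm *)

Definition size (j : job) (i : nat) : R := match ptime j i with Some x => x | None => 0 end.

(** Keeping only half of the slack leaves an admission window [[r, d - p - s]] of length at least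
    [s]. The cap by the size keeps the length [p + s] of an admission interval comparable to [p]. *)
Definition margin (j : job) (i : nat) : R := Rmin (dl j - rel j - size j i) (size j i) / 2.

(** The strict inequality makes the margin positive. It replaces the slack parameter, which the
    algorithm does not know. *)
Definition eligible (j : job) (i : nat) : Prop :=
  (exists x, ptime j i = Some x) /\ size j i < dl j - rel j.

Record admission := Adm { ajob : job; amach : nat; atime : R }.

Definition asize (a : admission) : R := size (ajob a) (amach a).
Definition amargin (a : admission) : R := margin (ajob a) (amach a).
Definition aend (a : admission) : R := atime a + asize a + amargin a.
Definition awt (a : admission) : R := wt (ajob a).

(* The loss charged to [a] when a job of size [p] is admitted on machine [i] at time [t]:
   the share of the margin of [a] that it may use up. *)
Definition harm (a : admission) (i : nat) (p t : R) : R :=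
  if excluded_middle_informative (amach a = i /\ atime a <= t < aend a)
  then awt a * Rmin 1 (p / amargin a) else 0.

(** Requiring [t] to be no earlier than the times in [A] makes the admissions chronological. The
    factor 2 in the last condition limits the harm done by a newcomer to half of its weight. *)
Definition admissible (m : nat) (I : instance) (A : list admission) (j : job) (i : nat) (t : R) : Prop :=
  In j I /\ (i < m)%nat /\ ~ In j (map ajob A) /\ eligible j i /\
  rel j <= t <= dl j - size j i - margin j i /\
  (forall a, In a A -> atime a <= t) /\
  2 * sumR (fun a => harm a i (size j i) t) A <= wt j.

Definition next (m : nat) (I : instance) (A : list admission) (a : admission) : Prop :=
  admissible m I A (ajob a) (amach a) (atime a) /\
  forall j i t, admissible m I A j i t -> atime a <= t.

Definition some_admission : admission := Adm (Job 0 0 0 0 (fun _ => None)) 0 0.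

(* [epsilon] depends only on the predicate, hence the choice among simultaneous candidates
   does not depend on the order of [I] nor on jobs released later. *)
Fixpoint admissions (m : nat) (I : instance) (n : nat) : list admission :=
  match n with
  | O => []
  | S n => let A := admissions m I n in
      if excluded_middle_informative (exists a, next m I A a)
      then A ++ [epsilon (inhabits some_admission) (next m I A)] else A
  end.

(** Greedy filling: the job takes every gap of [B] from [x] on until [p] units are placed. When [B]
    is sorted and starts no earlier than [x], the last branch means [x = sstart b], so that there is
    no gap before [b]. *)
Fixpoint ins (i k : nat) (x p : R) (B : schedule) : schedule :=
  match B with
  | [] => [Seg i k x (x + p)]
  | b :: B' =>
      if Rle_dec (x + p) (sstart b) then Seg i k x (x + p) :: B
      else if Rlt_dec x (sstart b)
      then Seg i k x (sstart b) :: b :: ins i k (send b) (p - (sstart b - x)) B'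
      else b :: ins i k (send b) p B'
  end.

(* Later admissions have priority: an earlier one only gets the gaps that they leave. *)
Fixpoint sched (i : nat) (A : list admission) : schedule :=
  match A with
  | [] => []
  | a :: L => if Nat.eqb (amach a) i then ins i (jid (ajob a)) (atime a) (asize a) (sched i L)
              else sched i L
  end.

Definition lifo : algorithm := fun m I =>
  flat_map (fun i => sched i (admissions m I (length I))) (seq 0 m).

(* Between the times listed here the left-hand side of the admission test is constant, so an
   earliest admissible time exists. *)
Lemma admissible_snap m I A j i t :
  admissible m I A j i t ->
  exists t', In t' (map rel I ++ map atime A ++ map aend A) /\ t' <= t /\ admissible m I A j i t'.
Proof.
  intros (Hj & Hi & Hn & He & Ht & Hl & Hs).
  destruct (arg_min Ropp (fun x => x <= t) (map rel I ++ map atime A ++ map aend A))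
    as [t' [Hin [Hle Hmax]]].
  { exists (rel j). split; [|easy]. apply in_app_iff. left. now apply in_map. }
  assert (Hmax' : forall y, In y (map rel I ++ map atime A ++ map aend A) -> y <= t -> y <= t').
  { intros y Hy Hyt. specialize (Hmax y Hy Hyt). lra. }
  exists t'. split; [easy|]. split; [easy|].
  refine (conj Hj (conj Hi (conj Hn (conj He (conj (conj _ _) (conj _ _)))))).
  - apply Hmax'; [|tauto]. apply in_app_iff. left. now apply in_map.
  - lra.
  - intros a Ha. apply Hmax'; [|now apply Hl].
    apply in_app_iff. right. apply in_app_iff. left. now apply in_map.
  - erewrite sumR_ext; [exact Hs|].
    intros a Ha. unfold harm.
    assert (atime a <= t').
    { apply Hmax'; [|now apply Hl].
      apply in_app_iff. right. apply in_app_iff. left. now apply in_map. }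
    assert (aend a <= t -> aend a <= t').
    { intros Hat. apply Hmax'; [|easy].
      apply in_app_iff. right. apply in_app_iff. right. now apply in_map. }
    destruct excluded_middle_informative as [H1|H1];
      destruct excluded_middle_informative as [H2|H2]; try reflexivity; exfalso.
    + apply H2. split; [tauto|]. split; [lra|].
      apply Rnot_le_lt. intros H3. specialize (H0 H3). lra.
    + apply H1. split; [tauto|]. split; [lra|]. lra.
Qed.

(** Every admissible time has an admissible breakpoint at or before it, and the breakpoints are
    finitely many, so the earliest admissible time is attained. *)
Lemma next_exists m I A j i t : admissible m I A j i t -> exists a, next m I A a.
Proof.
  intros H.
  destruct (arg_min (fun x => x) (fun x => exists j i, admissible m I A j i x)
              (map rel I ++ map atime A ++ map aend A)) as [x [Hx [[j0 [i0 H0]] Hmin]]].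
  { destruct (admissible_snap _ _ _ _ _ _ H) as [t' [H1 [_ H2]]]. eauto. }
  exists (Adm j0 i0 x). split; [exact H0|].
  intros j1 i1 t1 H1. simpl.
  destruct (admissible_snap _ _ _ _ _ _ H1) as [t' [H2 [H3 H4]]].
  assert (x <= t') by eauto. lra.
Qed.

(** * Runs of the greedy rule and their invariants *)

Inductive run (m : nat) (I : instance) : list admission -> Prop :=
| run_nil : run m I []
| run_snoc A a : run m I A -> next m I A a -> run m I (A ++ [a]).

Lemma admissions_step m I n :
  (exists a, next m I (admissions m I n) a /\ admissions m I (S n) = admissions m I n ++ [a]) \/
  ((forall j i t, ~ admissible m I (admissions m I n) j i t) /\ admissions m I (S n) = admissions m I n).
Proof.
  simpl. destruct excluded_middle_informative as [H|H].
  - left. eexists. split; [|reflexivity]. now apply epsilon_spec.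
  - right. split; [|reflexivity]. intros j i t Ha. apply H. eapply next_exists, Ha.
Qed.

(** The invariants of [run] hold for any choice among simultaneous candidates, hence for the one
    made by [epsilon]. *)
Lemma admissions_run m I n : run m I (admissions m I n).
Proof.
  induction n as [|n IH]; [constructor|].
  destruct (admissions_step m I n) as [[a [H ->]]|[_ ->]]; [now constructor|easy].
Qed.

Fixpoint ordered (A : list admission) : Prop :=
  match A with
  | [] => True
  | a :: L => (forall b, In b L -> atime a <= atime b) /\ ordered L
  end.

Lemma ordered_snoc A a :
  ordered A -> (forall b, In b A -> atime b <= atime a) -> ordered (A ++ [a]).
Proof.
  induction A as [|c A IH]; simpl; intros H1 H2; [split; [intros b []|exact Logic.I]|].
  destruct H1 as [H1 H3]. split.
  - intros b Hb. apply in_app_iff in Hb. destruct Hb as [Hb|[<-|[]]]; auto.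
  - apply IH; auto.
Qed.

Lemma run_ordered m I A : run m I A -> ordered A.
Proof.
  induction 1 as [|A a _ IH Hn]; [exact Logic.I|].
  apply ordered_snoc; [easy|]. apply Hn.
Qed.

Lemma NoDup_snoc {T} (l : list T) x : NoDup l -> ~ In x l -> NoDup (l ++ [x]).
Proof.
  intros H1 H2. apply NoDup_app; [easy|repeat constructor; easy|].
  intros y Hy [->|[]]. easy.
Qed.

Lemma run_NoDup m I A : run m I A -> NoDup (map ajob A).
Proof.
  induction 1 as [|A a _ IH Hn]; [constructor|].
  rewrite map_app. apply NoDup_snoc; [easy|]. apply Hn.
Qed.

Lemma run_sound m I A a : run m I A -> In a A ->
  In (ajob a) I /\ (amach a < m)%nat /\ eligible (ajob a) (amach a) /\
  rel (ajob a) <= atime a /\ aend a <= dl (ajob a).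
Proof.
  induction 1 as [|A b _ IH Hn]; intros Ha; [easy|].
  apply in_app_iff in Ha. destruct Ha as [Ha|[<-|[]]]; [now apply IH|].
  destruct Hn as [(H1 & H2 & H3 & H4 & H5 & _) _].
  unfold aend, asize, amargin. repeat split; try tauto; try apply H4; lra.
Qed.

Lemma NoDup_instance I : valid_instance I -> NoDup I.
Proof. intros [H _]. eapply NoDup_map_inv, H. Qed.

Lemma jid_inj I j1 j2 : valid_instance I -> In j1 I -> In j2 I -> jid j1 = jid j2 -> j1 = j2.
Proof.
  intros [H _]. induction I as [|j I IH]; intros H1 H2 He; [easy|].
  simpl in H. apply NoDup_cons_iff in H. destruct H as [Hn H].
  destruct H1 as [<-|H1], H2 as [<-|H2]; auto.
  - exfalso. apply Hn. rewrite He. now apply in_map.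
  - exfalso. apply Hn. rewrite <- He. now apply in_map.
Qed.

Lemma size_pos I j i : valid_instance I -> In j I -> eligible j i -> 0 < size j i.
Proof.
  intros (_ & _ & H) Hj [[x Hx] _]. unfold size. rewrite Hx. eapply H; eauto.
Qed.

Lemma margin_pos j i : 0 < size j i -> eligible j i -> 0 < margin j i.
Proof. intros H1 [_ H2]. unfold margin, Rmin. destruct Rle_dec; lra. Qed.

Lemma margin_le j i : 2 * margin j i <= size j i.
Proof. unfold margin, Rmin. destruct Rle_dec; lra. Qed.

Lemma margin_le_slack j i : 2 * margin j i <= dl j - rel j - size j i.
Proof. unfold margin, Rmin. destruct Rle_dec; lra. Qed.

Lemma admissions_length m I n :
  length (admissions m I n) = n \/ forall j i t, ~ admissible m I (admissions m I n) j i t.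
Proof.
  induction n as [|n IH]; [now left|].
  destruct (admissions_step m I n) as [[a [Ha ->]]|[Hn ->]]; [|now right].
  destruct IH as [IH|IH].
  - left. rewrite length_app. simpl. lia.
  - exfalso. eapply IH. apply Ha.
Qed.

Lemma admissions_complete m I n : valid_instance I -> (length I <= n)%nat ->
  forall j i t, ~ admissible m I (admissions m I n) j i t.
Proof.
  intros HI Hl. destruct (admissions_length m I n) as [He|He]; [|easy].
  intros j i t Ha. assert (Hr := admissions_run m I n).
  assert (In j (map ajob (admissions m I n))); [|now apply Ha].
  assert (Hinc : incl I (map ajob (admissions m I n))); [|apply Hinc, Ha].
  apply NoDup_length_incl.
  - eapply run_NoDup, Hr.
  - rewrite length_map. lia.
  - intros x Hx. apply in_map_iff in Hx. destruct Hx as [a [<- Hx]].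
    eapply run_sound; eauto.
Qed.

Lemma admissions_stable m I n : valid_instance I -> (length I <= n)%nat ->
  admissions m I n = admissions m I (length I).
Proof.
  intros HI. induction 1 as [|n Hn IH]; [easy|].
  destruct (admissions_step m I n) as [[a [Ha _]]|[_ ->]]; [|easy].
  exfalso. eapply admissions_complete; eauto. apply Ha.
Qed.

(** Look at the step that made the first admission later than [t]. It took an earliest candidate, so
    [j] was no candidate at [t], and only the harm test can have failed. Later admissions start
    after [t] and add no harm there. *)
Lemma run_blocked m I A j i t : run m I A ->
  In j I -> ~ In j (map ajob A) -> (i < m)%nat -> eligible j i ->
  rel j <= t <= dl j - size j i - margin j i ->
  (exists a, In a A /\ t < atime a) ->
  wt j < 2 * sumR (fun a => harm a i (size j i) t) A.
Proof.
  intros Hr Hj Hn Hi He Ht. revert Hn. induction Hr as [|A a Hr IH [Hn1 Hn2]].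
  - intros _ [a [[] _]].
  - rewrite map_app. intros Hn [b [Hb Hbt]].
    assert (Hn' : ~ In j (map ajob A)) by (intros Hx; apply Hn; apply in_app_iff; now left).
    assert (Hlt : t < atime a).
    { apply in_app_iff in Hb. destruct Hb as [Hb|[<-|[]]]; [|easy].
      assert (atime b <= atime a) by now apply Hn1. lra. }
    assert (Hs : wt j < 2 * sumR (fun a => harm a i (size j i) t) A).
    { destruct (classic (exists a, In a A /\ t < atime a)) as [Hex|Hnex]; [now apply IH|].
      apply Rnot_le_lt. intros Hle.
      assert (atime a <= t); [|lra]. apply (Hn2 j i t).
      refine (conj Hj (conj Hi (conj Hn' (conj He (conj Ht (conj _ _)))))); [|lra].
      intros c Hc. apply Rnot_lt_le. intros Hct. apply Hnex. eauto. }
    rewrite sumR_app. simpl. unfold harm at 2.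
    destruct excluded_middle_informative as [Hc|Hc]; lra.
Qed.

(** At a time followed by no admission, completeness of the final list replaces the choice of the
    earliest candidate. *)
Lemma admissions_blocked m I j i t : valid_instance I ->
  In j I -> ~ In j (map ajob (admissions m I (length I))) -> (i < m)%nat -> eligible j i ->
  rel j <= t <= dl j - size j i - margin j i ->
  wt j <= 2 * sumR (fun a => harm a i (size j i) t) (admissions m I (length I)).
Proof.
  intros HI Hj Hn Hi He Ht.
  destruct (classic (exists a, In a (admissions m I (length I)) /\ t < atime a)) as [Hex|Hnex].
  - apply Rlt_le. eapply run_blocked; eauto. apply admissions_run.
  - apply Rnot_lt_le. intros Hlt.
    apply (admissions_complete m I (length I) HI (le_n _) j i t).
    refine (conj Hj (conj Hi (conj Hn (conj He (conj Ht (conj _ _)))))); [|lra].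
    intros c Hc. apply Rnot_lt_le. intros Hct. apply Hnex. eauto.
Qed.

(** * Admissions up to a given time *)

Lemma admissible_local m I I' t A j i x :
  (forall j, (In j I /\ rel j <= t) <-> (In j I' /\ rel j <= t)) ->
  x <= t -> admissible m I A j i x -> admissible m I' A j i x.
Proof.
  intros Hag Hx (Hj & Hi & Hn & He & Ht & Hl & Hs).
  refine (conj _ (conj Hi (conj Hn (conj He (conj Ht (conj Hl Hs)))))).
  apply Hag. split; [easy|lra].
Qed.

Lemma next_local m I I' t A a :
  (forall j, (In j I /\ rel j <= t) <-> (In j I' /\ rel j <= t)) ->
  atime a <= t -> next m I A a -> next m I' A a.
Proof.
  intros Hag Ha [H1 H2]. split.
  - eapply admissible_local; eauto.
  - intros j i x Hx. destruct (Rle_dec x t); [|lra].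
    apply (H2 j i). apply (admissible_local m I' I t); auto. intros; symmetry; apply Hag.
Qed.

(** Equality of the two predicates, and not just equivalence, is what makes [epsilon] return the
    same candidate for both instances. *)
Lemma next_local_eq m I I' t A a :
  (forall j, (In j I /\ rel j <= t) <-> (In j I' /\ rel j <= t)) ->
  atime a <= t -> next m I A a -> next m I A = next m I' A.
Proof.
  intros Hag Ha Hn. assert (Hn' := next_local _ _ _ _ _ _ Hag Ha Hn).
  apply functional_extensionality. intros b. apply propositional_extensionality.
  split; intros Hb.
  - eapply next_local; eauto.
    assert (atime b <= atime a) by (eapply Hb, Hn). lra.
  - apply (next_local m I' I t); auto; [intros; symmetry; apply Hag|].
    assert (atime b <= atime a) by (eapply Hb, Hn'). lra.
Qed.

Lemma admissions_step_late m I t A1 A2 n :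
  admissions m I n = A1 ++ A2 ->
  (forall a, In a A2 -> t < atime a) ->
  (forall j i x, admissible m I A1 j i x -> t < x) ->
  exists A2', admissions m I (S n) = A1 ++ A2' /\ forall a, In a A2' -> t < atime a.
Proof.
  intros He Hl Hno. destruct (admissions_step m I n) as [[a [Ha ->]]|[_ ->]]; rewrite He in *; eauto.
  exists (A2 ++ [a]). rewrite app_assoc. split; [easy|].
  intros b Hb. apply in_app_iff in Hb. destruct Hb as [Hb|[<-|[]]]; auto.
  destruct A2 as [|c A2].
  - rewrite app_nil_r in Ha. eapply Hno, Ha.
  - assert (t < atime c) by (apply Hl; now left).
    assert (atime c <= atime a); [|lra]. apply Ha. apply in_app_iff. right. now left.
Qed.

(** The two runs take identical steps as long as the next admission is at or before [t]; from then
    on each adds only admissions later than [t]. *)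
Lemma admissions_local m I I' t n :
  (forall j, (In j I /\ rel j <= t) <-> (In j I' /\ rel j <= t)) ->
  exists A1 A2 A2', admissions m I n = A1 ++ A2 /\ admissions m I' n = A1 ++ A2' /\
    (forall a, In a A2 -> t < atime a) /\ (forall a, In a A2' -> t < atime a).
Proof.
  intros Hag.
  assert (Hag' : forall j, (In j I' /\ rel j <= t) <-> (In j I /\ rel j <= t)) by (intros; symmetry; apply Hag).
  (* The induction also records the phase: either the two lists still coincide, or [A1] has no
     candidate at or before [t] in either instance. *)
  enough (exists A1 A2 A2', admissions m I n = A1 ++ A2 /\ admissions m I' n = A1 ++ A2' /\
    (forall a, In a A2 -> t < atime a) /\ (forall a, In a A2' -> t < atime a) /\
    ((A2 = [] /\ A2' = []) \/
     (forall j i x, admissible m I A1 j i x -> t < x) /\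
     (forall j i x, admissible m I' A1 j i x -> t < x))) as (A1 & A2 & A2' & H).
  { exists A1, A2, A2'. tauto. }
  induction n as [|n (A1 & A2 & A2' & E & E' & L & L' & C)].
  { exists [], [], []. simpl. tauto. }
  assert (Hstay : (forall j i x, admissible m I A1 j i x -> t < x) ->
                  (forall j i x, admissible m I' A1 j i x -> t < x) ->
    exists A1 A2 A2', admissions m I (S n) = A1 ++ A2 /\ admissions m I' (S n) = A1 ++ A2' /\
    (forall a, In a A2 -> t < atime a) /\ (forall a, In a A2' -> t < atime a) /\
    ((A2 = [] /\ A2' = []) \/
     (forall j i x, admissible m I A1 j i x -> t < x) /\
     (forall j i x, admissible m I' A1 j i x -> t < x))).
  { intros H H'.
    destruct (admissions_step_late m I t A1 A2 n E L H) as [B [HB1 HB2]].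
    destruct (admissions_step_late m I' t A1 A2' n E' L' H') as [B' [HB1' HB2']].
    exists A1, B, B'. tauto. }
  destruct C as [[-> ->]|[C1 C2]]; [|now apply Hstay].
  rewrite app_nil_r in *.
  destruct (classic (exists a, next m I A1 a /\ atime a <= t)) as [[a [Ha Hat]]|Hno].
  - assert (Heq := next_local_eq _ _ _ _ _ _ Hag Hat Ha).
    exists (admissions m I (S n)), [], []. rewrite app_nil_r. repeat split; try easy; [|now left].
    simpl. rewrite E, E', Heq. reflexivity.
  - assert (Hno1 : forall j i x, admissible m I A1 j i x -> t < x).
    { intros j i x Hx. apply Rnot_le_lt. intros Hle. apply Hno.
      destruct (next_exists _ _ _ _ _ _ Hx) as [a Ha]. exists a. split; [easy|].
      assert (atime a <= x) by (eapply Ha, Hx). lra. }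
    apply Hstay; [easy|].
    intros j i x Hx. apply Rnot_le_lt. intros Hle.
    assert (t < x); [|lra]. eapply Hno1, (admissible_local m I' I t); eauto.
Qed.

(** * Locality of the schedule *)

Definition late (t : R) (B : schedule) : Prop := forall b, In b B -> t < sstart b /\ t < send b.

(* Equality on [(-oo, t]]; a segment in progress at time [t] may end at different times. *)
Inductive agree (t : R) : schedule -> schedule -> Prop :=
| agree_late B B' : late t B -> late t B' -> agree t B B'
| agree_cut i k s e e' B B' : t < e -> t < e' -> late t B -> late t B' ->
    agree t (Seg i k s e :: B) (Seg i k s e' :: B')
| agree_cons b B B' : agree t B B' -> agree t (b :: B) (b :: B').

Lemma late_cons t b B : t < sstart b -> t < send b -> late t B -> late t (b :: B).
Proof. intros H1 H2 H3 c [<-|Hc]; auto. Qed.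

Lemma late_inv t b B : late t (b :: B) -> t < sstart b /\ t < send b /\ late t B.
Proof. intros H. split; [|split]; [apply H; now left..|]. intros c Hc; apply H; now right. Qed.

Lemma late_ins t i k x p B : 0 < p -> t < x -> late t B -> late t (ins i k x p B).
Proof.
  revert x p. induction B as [|b B IH]; intros x p Hp Hx HB; simpl.
  - apply late_cons; simpl; try lra; easy.
  - apply late_inv in HB. destruct HB as (H1 & H2 & H3).
    destruct Rle_dec; [|destruct Rlt_dec].
    + apply late_cons; simpl; try lra. now apply late_cons.
    + apply late_cons; simpl; try lra. apply late_cons; try lra. apply IH; try lra; easy.
    + apply late_cons; try lra. apply IH; try lra; easy.
Qed.

(** Up to [t] the gaps of [B] and [B'] coincide, so the inserted pieces do too. A piece in progress
    at [t] may be cut at different later times, which is what [agree_cut] allows. *)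
Lemma agree_ins t i k x p B B' : 0 < p -> agree t B B' -> agree t (ins i k x p B) (ins i k x p B').
Proof.
  intros Hp HB. revert x p Hp. induction HB as [B B' HB HB'|i' k' s e e' B B' He He' HB HB'|b B B' HB IH];
    intros x p Hp.
  - destruct (Rlt_dec t x) as [Hx|Hx]; [apply agree_late; now apply late_ins|].
    destruct B as [|b B], B' as [|b' B']; simpl;
      try (apply late_inv in HB; destruct HB as (H1 & H2 & H3));
      try (apply late_inv in HB'; destruct HB' as (H1' & H2' & H3'));
      repeat (destruct Rle_dec; try lra); repeat (destruct Rlt_dec; try lra);
      try (apply agree_cons; apply agree_late; repeat apply late_cons; easy);
      (apply agree_cut; try lra; repeat apply late_cons; try easy; apply late_ins; try lra; easy).
  - simpl. destruct Rle_dec; [|destruct Rlt_dec].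
    + apply agree_cons. now apply agree_cut.
    + apply agree_cons. apply agree_cut; try easy; apply late_ins; try lra; easy.
    + apply agree_cut; try easy; apply late_ins; try lra; easy.
  - simpl. destruct Rle_dec; [|destruct Rlt_dec].
    + apply agree_cons. now apply agree_cons.
    + do 2 apply agree_cons. apply IH. lra.
    + apply agree_cons. now apply IH.
Qed.

Lemma agree_processes t i k B B' : agree t B B' -> processes B i k t -> processes B' i k t.
Proof.
  intros HB (a & Ha & H1 & H2 & H3). revert Ha.
  induction HB as [B B' HB HB'|i' k' s e e' B B' He He' HB HB'|b B B' HB IH]; intros Ha.
  - specialize (HB a Ha). lra.
  - destruct Ha as [<-|Ha]; [|specialize (HB a Ha); lra].
    eexists. split; [now left|]. simpl in *. repeat split; try easy; lra.
  - destruct Ha as [<-|Ha].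
    + exists b. split; [now left|easy].
    + destruct (IH Ha) as (c & Hc & H). exists c. split; [now right|easy].
Qed.

Lemma sched_late t i A :
  (forall a, In a A -> t < atime a /\ 0 < asize a) -> late t (sched i A).
Proof.
  induction A as [|a A IH]; intros H; simpl; [easy|].
  assert (late t (sched i A)) by (apply IH; intros; apply H; now right).
  destruct Nat.eqb; [|easy]. apply late_ins; try easy; apply H; now left.
Qed.

Lemma sched_agree t i A1 A2 A2' :
  (forall a, In a A1 -> 0 < asize a) ->
  (forall a, In a A2 -> t < atime a /\ 0 < asize a) ->
  (forall a, In a A2' -> t < atime a /\ 0 < asize a) ->
  agree t (sched i (A1 ++ A2)) (sched i (A1 ++ A2')).
Proof.
  intros H1 H2 H3. induction A1 as [|a A1 IH]; simpl.
  - apply agree_late; now apply sched_late.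
  - assert (agree t (sched i (A1 ++ A2)) (sched i (A1 ++ A2')))
      by (apply IH; intros; apply H1; now right).
    destruct Nat.eqb; [|easy]. apply agree_ins; [|easy]. apply H1; now left.
Qed.

Lemma asize_pos m I A a : valid_instance I -> run m I A -> In a A -> 0 < asize a.
Proof. intros HI Hr Ha. destruct (run_sound _ _ _ _ Hr Ha) as (H1 & _ & H2 & _). eapply size_pos; eauto. Qed.

Lemma lifo_online : online lifo.
Proof.
  enough (H : forall m I I' t, valid_instance I -> valid_instance I' ->
    (forall j, (In j I /\ rel j <= t) <-> (In j I' /\ rel j <= t)) ->
    forall i k, processes (lifo m I) i k t -> processes (lifo m I') i k t).
  { intros m I I' t HI HI' Hag i k. split; apply H; auto. intros; symmetry; apply Hag. }
  intros m I I' t HI HI' Hag i k (a & Ha & Hp).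
  apply in_flat_map in Ha. destruct Ha as [i0 [Hi0 Ha]].
  enough (processes (sched i0 (admissions m I' (length I'))) i k t) as (b & Hb & Hb').
  { exists b. split; [|easy]. apply in_flat_map. eauto. }
  (* Extra rounds do not change a finished run, so both runs can be compared after the same number
     of rounds. *)
  set (n := Nat.max (length I) (length I')).
  rewrite <- (admissions_stable m I n) in Ha by (try easy; lia).
  rewrite <- (admissions_stable m I' n) by (try easy; lia).
  assert (Hr := admissions_run m I n). assert (Hr' := admissions_run m I' n).
  destruct (admissions_local m I I' t n Hag) as (A1 & A2 & A2' & E & E' & L & L').
  rewrite E in *. rewrite E' in *.
  apply (agree_processes t i k (sched i0 (A1 ++ A2))); [apply sched_agree|].
  - intros c Hc. eapply asize_pos; [exact HI|exact Hr|]. apply in_app_iff. now left.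
  - intros c Hc. split; [now apply L|].
    eapply asize_pos; [exact HI|exact Hr|]. apply in_app_iff. now right.
  - intros c Hc. split; [now apply L'|].
    eapply asize_pos; [exact HI'|exact Hr'|]. apply in_app_iff. now right.
  - exists a. easy.
Qed.

(** * Feasibility and guaranteed completion *)

Fixpoint chain (x : R) (B : schedule) : Prop :=
  match B with
  | [] => True
  | b :: B' => x <= sstart b /\ sstart b < send b /\ chain (send b) B'
  end.

Lemma chain_weaken x y B : y <= x -> chain x B -> chain y B.
Proof. destruct B as [|b B]; simpl; [easy|]. intros H (H1 & H2 & H3). repeat split; try easy; lra. Qed.

Lemma chain_start x B b : chain x B -> In b B -> x <= sstart b /\ sstart b < send b.
Proof.
  revert x. induction B as [|c B IH]; intros x H Hb; [easy|].
  destruct H as (H1 & H2 & H3). destruct Hb as [<-|Hb]; [lra|].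
  destruct (IH _ H3 Hb). lra.
Qed.

Lemma chain_ins i k x p B : 0 < p -> chain x B -> chain x (ins i k x p B).
Proof.
  revert x p. induction B as [|b B IH]; intros x p Hp H; simpl; [repeat split; lra|].
  destruct H as (H1 & H2 & H3).
  destruct Rle_dec; [|destruct Rlt_dec]; simpl; repeat split; try lra; try easy; apply IH; try lra; easy.
Qed.

Lemma chain_sched i A x : ordered A -> (forall a, In a A -> 0 < asize a /\ x <= atime a) ->
  chain x (sched i A).
Proof.
  revert x. induction A as [|a A IH]; intros x Ho H; simpl; [easy|].
  destruct Ho as [Ho1 Ho2].
  destruct Nat.eqb.
  - apply (chain_weaken (atime a)); [apply H; now left|].
    apply chain_ins; [apply H; now left|].
    apply IH; [easy|]. intros b Hb. split; [apply H; now right|now apply Ho1].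
  - apply IH; [easy|]. intros b Hb. apply H; now right.
Qed.

Lemma in_ins i k x p B b : In b (ins i k x p B) -> In b B \/ (smach b = i /\ sjob b = k).
Proof.
  revert x p. induction B as [|c B IH]; intros x p; simpl.
  - intros [<-|[]]. now right.
  - destruct Rle_dec; [|destruct Rlt_dec]; simpl; intros H.
    + destruct H as [<-|[<-|H]]; auto.
    + destruct H as [<-|[<-|H]]; auto. destruct (IH _ _ H); auto.
    + destruct H as [<-|H]; auto. destruct (IH _ _ H); auto.
Qed.

Lemma in_ins_start i k x p B b : chain x B -> 0 < p -> In b (ins i k x p B) -> x <= sstart b.
Proof. intros H Hp Hb. eapply chain_start; [|exact Hb]. now apply chain_ins. Qed.

Lemma in_sched i A b : ordered A -> (forall a, In a A -> 0 < asize a) -> In b (sched i A) ->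
  exists a, In a A /\ amach a = i /\ smach b = i /\ sjob b = jid (ajob a).
Proof.
  induction A as [|a A IH]; intros Ho Hs Hb; [easy|]. simpl in Hb. destruct Ho as [Ho1 Ho2].
  assert (IH' : In b (sched i A) -> exists a0, In a0 (a :: A) /\ amach a0 = i /\ smach b = i /\ sjob b = jid (ajob a0)).
  { intros H. destruct IH as (c & Hc & Hc'); auto; [intros; apply Hs; now right|].
    exists c. split; [now right|easy]. }
  destruct (Nat.eqb_spec (amach a) i) as [Hi|Hi]; [|now apply IH'].
  destruct (in_ins _ _ _ _ _ _ Hb) as [H|[H1 H2]]; [now apply IH'|].
  exists a. split; [now left|easy].
Qed.

Lemma in_sched_rel i A b j : ordered A -> (forall a, In a A -> 0 < asize a) ->
  (forall a, In a A -> jid (ajob a) = jid j -> rel j <= atime a) ->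
  In b (sched i A) -> sjob b = jid j -> rel j <= sstart b.
Proof.
  induction A as [|a A IH]; intros Ho Hs Hr Hb Hj; [easy|]. simpl in Hb. destruct Ho as [Ho1 Ho2].
  assert (IH' : In b (sched i A) -> rel j <= sstart b).
  { intros H. apply IH; auto; intros c Hc; [apply Hs|apply Hr]; now right. }
  destruct Nat.eqb; [|now apply IH'].
  destruct (in_ins _ _ _ _ _ _ Hb) as [H|[H1 H2]]; [now apply IH'|].
  apply Rle_trans with (atime a).
  - apply Hr; [now left|congruence].
  - eapply in_ins_start; [| |exact Hb].
    + apply chain_sched; [easy|]. intros c Hc. split; [apply Hs; now right|now apply Ho1].
    + apply Hs; now left.
Qed.

(** With [nth_of_pairs] this translates between the index form of feasibility and [ForallOrdPairs],
    which suits induction, concatenation and filtering. *)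
Lemma pairs_of_nth {T} (Q : T -> T -> Prop) (d : T) l :
  (forall k1 k2, (k1 < length l)%nat -> (k2 < length l)%nat -> k1 <> k2 ->
     Q (nth k1 l d) (nth k2 l d)) -> ForallOrdPairs Q l.
Proof.
  induction l as [|x l IH]; intros H; constructor.
  - apply Forall_forall. intros y Hy. destruct (In_nth _ _ d Hy) as (n & Hn & <-).
    apply (H 0%nat (S n)); simpl; lia.
  - apply IH. intros k1 k2 H1 H2 H3. apply (H (S k1) (S k2)); simpl; lia.
Qed.

Lemma nth_of_pairs {T} (Q : T -> T -> Prop) (d : T) l :
  (forall x y, Q x y -> Q y x) -> ForallOrdPairs Q l ->
  forall k1 k2, (k1 < length l)%nat -> (k2 < length l)%nat -> k1 <> k2 ->
     Q (nth k1 l d) (nth k2 l d).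
Proof.
  intros Hsym. induction 1 as [|x l Hx Hl IH]; simpl; intros k1 k2 H1 H2 H3; [lia|].
  rewrite Forall_forall in Hx.
  destruct k1 as [|k1], k2 as [|k2]; try lia.
  - apply Hx, nth_In. lia.
  - apply Hsym, Hx, nth_In. lia.
  - apply IH; lia.
Qed.

Lemma pairs_app {T} (Q : T -> T -> Prop) l1 l2 :
  ForallOrdPairs Q l1 -> ForallOrdPairs Q l2 ->
  (forall x y, In x l1 -> In y l2 -> Q x y) -> ForallOrdPairs Q (l1 ++ l2).
Proof.
  intros H1 H2. induction H1 as [|x l Hx Hl IH]; simpl; intros H; [easy|].
  constructor.
  - apply Forall_app. split; [easy|]. apply Forall_forall. intros y Hy. apply H; [now left|easy].
  - apply IH. intros; apply H; [now right|easy].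
Qed.

Lemma pairs_filter {T} (Q : T -> T -> Prop) (f : T -> bool) l :
  ForallOrdPairs Q l -> ForallOrdPairs Q (filter f l).
Proof.
  induction 1 as [|x l Hx Hl IH]; simpl; [constructor|].
  destruct (f x); [|easy]. constructor; [|easy].
  rewrite Forall_forall in *. intros y Hy. apply filter_In in Hy. now apply Hx.
Qed.

Lemma pairs_impl {T} (Q Q' : T -> T -> Prop) l :
  (forall x y, In x l -> In y l -> Q x y -> Q' x y) -> ForallOrdPairs Q l -> ForallOrdPairs Q' l.
Proof.
  intros H Hl. induction Hl as [|x l Hx Hl IH]; constructor.
  - rewrite Forall_forall in *. intros y Hy. apply H; [now left|now right|auto].
  - apply IH. intros; apply H; auto; now right.
Qed.

Lemma chain_disjoint x B : chain x B -> ForallOrdPairs disjoint_seg B.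
Proof.
  revert x. induction B as [|b B IH]; intros x H; constructor; destruct H as (H1 & H2 & H3).
  - apply Forall_forall. intros c Hc. left. eapply chain_start; eauto.
  - eapply IH, H3.
Qed.

Definition same_machine_disjoint (a b : segment) : Prop := smach a = smach b -> disjoint_seg a b.

Lemma flat_map_sched_disjoint A l : NoDup l -> ordered A -> (forall a, In a A -> 0 < asize a) ->
  ForallOrdPairs same_machine_disjoint (flat_map (fun i => sched i A) l).
Proof.
  intros Hl Ho Hs. induction Hl as [|i l Hi Hl IH]; simpl; [constructor|].
  apply pairs_app; [|easy|].
  - assert (exists x, chain x (sched i A)) as [x Hx].
    { destruct A as [|a A]; [exists 0; exact Logic.I|]. exists (atime a).
      apply chain_sched; [easy|]. intros b Hb. split; [auto|].
      destruct Hb as [<-|Hb]; [lra|]. now apply Ho. }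
    eapply pairs_impl; [|eapply chain_disjoint, Hx]. intros b c _ _ H _. exact H.
  - intros b c Hb Hc He. exfalso. apply in_flat_map in Hc. destruct Hc as [i' [Hi' Hc]].
    destruct (in_sched _ _ _ Ho Hs Hb) as (_ & _ & _ & Eb & _).
    destruct (in_sched _ _ _ Ho Hs Hc) as (_ & _ & _ & Ec & _).
    apply Hi. congruence.
Qed.

Lemma NoDup_map_inj {T U} (f : T -> U) l x y :
  NoDup (map f l) -> In x l -> In y l -> f x = f y -> x = y.
Proof.
  induction l as [|z l IH]; simpl; intros Hn Hx Hy He; [easy|].
  apply NoDup_cons_iff in Hn. destruct Hn as [Hz Hn].
  destruct Hx as [<-|Hx], Hy as [<-|Hy]; auto; exfalso; apply Hz.
  - rewrite He. now apply in_map.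
  - rewrite <- He. now apply in_map.
Qed.

Lemma lifo_feasible m I : valid_instance I -> feasible_nm m I (lifo m I).
Proof.
  intros HI. unfold lifo. assert (Hr := admissions_run m I (length I)).
  set (A := admissions m I (length I)) in *.
  assert (Ho := run_ordered _ _ _ Hr). assert (Hnd := run_NoDup _ _ _ Hr).
  assert (Hs : forall a, In a A -> 0 < asize a) by (intros; eapply asize_pos; eauto).
  assert (Horigin : forall b, In b (flat_map (fun i => sched i A) (seq 0 m)) ->
    exists a, In a A /\ smach b = amach a /\ sjob b = jid (ajob a) /\ In b (sched (amach a) A)).
  { intros b Hb. apply in_flat_map in Hb. destruct Hb as [i [_ Hb]].
    destruct (in_sched _ _ _ Ho Hs Hb) as (a & Ha & <- & H1 & H2). eauto 10. }
  assert (Hmach : forall b c, In b (flat_map (fun i => sched i A) (seq 0 m)) ->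
    In c (flat_map (fun i => sched i A) (seq 0 m)) -> sjob b = sjob c -> smach b = smach c).
  { intros b c Hb Hc He.
    destruct (Horigin b Hb) as (a & Ha & -> & Hja & _).
    destruct (Horigin c Hc) as (a' & Ha' & -> & Hja' & _).
    f_equal. apply (NoDup_map_inj ajob A); auto.
    apply (jid_inj I); try congruence; eapply run_sound; eauto. }
  assert (Hdis := flat_map_sched_disjoint A (seq 0 m) (seq_NoDup _ _) Ho Hs).
  split; [|split; [|split]].
  - intros b Hb. destruct (Horigin b Hb) as (a & Ha & E & E' & Hb').
    destruct (run_sound _ _ _ _ Hr Ha) as (H1 & H2 & H3 & H4 & H5).
    split; [now rewrite E|]. split.
    + assert (exists x, chain x (sched (amach a) A)) as [x Hx].
      { clearbody A. destruct A as [|c A0]; [easy|]. exists (atime c). apply chain_sched; [easy|].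
        intros d Hd. split; [auto|]. destruct Hd as [<-|Hd]; [lra|]. now apply Ho. }
      eapply chain_start; eauto.
    + exists (ajob a). split; [easy|].
      eapply (in_sched_rel (amach a) A); eauto.
      intros c Hc Hj. assert (ajob c = ajob a) as <-; [|eapply run_sound; eauto].
      apply (jid_inj I); auto. eapply run_sound; eauto.
  - apply (nth_of_pairs same_machine_disjoint); [|easy].
    intros b c H E. symmetry in E. destruct (H E); [now right|now left].
  - apply (nth_of_pairs (fun b c => sjob b = sjob c -> disjoint_seg b c)).
    + intros b c H E. symmetry in E. destruct (H E); [now right|now left].
    + eapply pairs_impl; [|exact Hdis]. intros b c Hb Hc H E. apply H. now apply Hmach.
  - exact Hmach.
Qed.

(** * Processing received by an admission *)

Definition busy (D : R) (B : schedule) : R := sumR (fun b => Rmax 0 (Rmin (send b) D - sstart b)) B.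

Lemma busy_nonneg D B : 0 <= busy D B.
Proof. apply sumR_nonneg. intros. apply Rmax_l. Qed.

Lemma Rmin_cases x y : (Rmin x y = x /\ x <= y) \/ (Rmin x y = y /\ y <= x).
Proof. unfold Rmin. destruct Rle_dec; lra. Qed.

Lemma Rmax_cases x y : (Rmax x y = x /\ y <= x) \/ (Rmax x y = y /\ x <= y).
Proof. unfold Rmax. destruct Rle_dec; lra. Qed.

Ltac split_minmax z H :=
  let w := fresh "w" in
  destruct H as [[? ?]|[? ?]]; set (w := z) in *; clearbody w.

Ltac minmax :=
  repeat match goal with
  | |- context [Rmin ?x ?y] => split_minmax (Rmin x y) (Rmin_cases x y)
  | |- context [Rmax ?x ?y] => split_minmax (Rmax x y) (Rmax_cases x y)
  | _ : context [Rmin ?x ?y] |- _ => split_minmax (Rmin x y) (Rmin_cases x y)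
  | _ : context [Rmax ?x ?y] |- _ => split_minmax (Rmax x y) (Rmax_cases x y)
  end; try lra.

Lemma busy_ins D i k x p B : 0 < p -> chain x B ->
  busy D (ins i k x p B) <= busy D B + (if Rlt_dec x D then p else 0).
Proof.
  revert x p. induction B as [|b B IH]; intros x p Hp H.
  - unfold busy; simpl. destruct Rlt_dec; minmax.
  - destruct H as (H1 & H2 & H3). simpl ins. unfold busy in *.
    destruct Rle_dec; [|destruct (Rlt_dec x (sstart b))]; simpl.
    + destruct Rlt_dec; minmax.
    + assert (Rmax 0 (Rmin (sstart b) D - x) <= if Rlt_dec x D then sstart b - x else 0)
        by (clear IH; destruct Rlt_dec; minmax).
      assert (H' := IH (send b) (p - (sstart b - x)) ltac:(lra) H3).
      repeat destruct Rlt_dec; lra.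
    + assert (H := IH (send b) p Hp H3). repeat destruct Rlt_dec; lra.
Qed.

Lemma busy_sched D i A : ordered A -> (forall a, In a A -> 0 < asize a) ->
  busy D (sched i A) <=
  sumR (fun a => if excluded_middle_informative (amach a = i /\ atime a < D) then asize a else 0) A.
Proof.
  induction A as [|a A IH]; intros Ho Hs; [unfold busy; simpl; lra|].
  destruct Ho as [Ho1 Ho2]. simpl.
  assert (H : forall b, In b A -> 0 < asize b) by (intros; apply Hs; now right).
  specialize (IH Ho2 H).
  destruct (Nat.eqb_spec (amach a) i) as [E|E].
  - assert (Hb : busy D (ins i (jid (ajob a)) (atime a) (asize a) (sched i A)) <=
      busy D (sched i A) + (if Rlt_dec (atime a) D then asize a else 0)).
    { apply busy_ins; [apply Hs; now left|]. apply chain_sched; auto. }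
    destruct Rlt_dec; destruct excluded_middle_informative as [Hc|Hc]; try tauto; lra.
  - destruct excluded_middle_informative as [Hc|Hc]; [tauto|lra].
Qed.

Lemma proc_app S1 S2 j i :
  proc_by_deadline (S1 ++ S2) j i = proc_by_deadline S1 j i + proc_by_deadline S2 j i.
Proof.
  induction S1 as [|a S1 IH]; simpl; [lra|]. destruct andb; [|easy].
  unfold proc_by_deadline in *. rewrite IH. lra.
Qed.

Lemma proc_cons a S j i : proc_by_deadline (a :: S) j i =
  (if andb (Nat.eqb (smach a) i) (Nat.eqb (sjob a) (jid j))
   then Rmax 0 (Rmin (send a) (dl j) - Rmax (sstart a) (rel j)) else 0) + proc_by_deadline S j i.
Proof. simpl. destruct andb; unfold proc_by_deadline; lra. Qed.

Lemma proc_cons_le a S j i : proc_by_deadline S j i <= proc_by_deadline (a :: S) j i.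
Proof.
  rewrite proc_cons. destruct andb; [|lra].
  assert (H := Rmax_l 0 (Rmin (send a) (dl j) - Rmax (sstart a) (rel j))). lra.
Qed.

Lemma proc_nonneg S j i : 0 <= proc_by_deadline S j i.
Proof.
  induction S as [|a S IH]; [unfold proc_by_deadline; simpl; lra|].
  eapply Rle_trans; [exact IH|apply proc_cons_le].
Qed.

Lemma proc_ins_le i' k x p B j i : proc_by_deadline B j i <= proc_by_deadline (ins i' k x p B) j i.
Proof.
  revert x p. induction B as [|b B IH]; intros x p; simpl ins.
  - apply proc_cons_le.
  - destruct Rle_dec; [|destruct Rlt_dec].
    + apply proc_cons_le.
    + eapply Rle_trans; [|apply proc_cons_le]. rewrite !(proc_cons b).
      specialize (IH (send b) (p - (sstart b - x))). lra.
    + rewrite !(proc_cons b). specialize (IH (send b) p). lra.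
Qed.

(** [B] leaves at least [p] units of [[x, D)] idle, and greedy filling uses idle time as early as
    possible, so all [p] units fit before [D]. *)
Lemma proc_ins D i x p B j : chain x B -> 0 < p -> rel j <= x -> D <= dl j ->
  x + p + busy D B <= D -> p <= proc_by_deadline (ins i (jid j) x p B) j i.
Proof.
  intros HB Hp Hx HD. revert x p HB Hp Hx. induction B as [|b B IH]; intros x p HB Hp Hx H.
  - unfold busy in H. simpl in *. rewrite !Nat.eqb_refl. simpl. minmax.
  - destruct HB as (H1 & H2 & H3).
    assert (Hb : busy D (b :: B) = Rmax 0 (Rmin (send b) D - sstart b) + busy D B) by reflexivity.
    assert (Hn := busy_nonneg D B).
    simpl ins. destruct Rle_dec; [|destruct Rlt_dec].
    + rewrite proc_cons. simpl smach; simpl sjob; simpl send; simpl sstart.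
      rewrite !Nat.eqb_refl. simpl.
      assert (Hp' := proc_nonneg (b :: B) j i).
      assert (x + p <= D) by (rewrite Hb in H; minmax).
      replace (proc_by_deadline (b :: B) j i) with (proc_by_deadline (b :: B) j i + 0) in * by lra.
      unfold proc_by_deadline in *. simpl in *.
      set (z := if (_ && _)%bool then _ else _) in *. clearbody z. minmax.
    (* If [b] ran past [D], the budget would force [x + p <= sstart b], the case already
       excluded. *)
    + assert (HD' : send b <= D) by (rewrite Hb in H; minmax).
      assert (IH' : p - (sstart b - x) <=
        proc_by_deadline (ins i (jid j) (send b) (p - (sstart b - x)) B) j i).
      { apply IH; try easy; try lra. rewrite Hb in H. minmax. }
      rewrite proc_cons. rewrite proc_cons.
      simpl smach; simpl sjob; simpl send; simpl sstart. rewrite !Nat.eqb_refl. simpl andb. cbv iota.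
      set (z := if (_ && _)%bool then _ else _).
      assert (0 <= z) by (unfold z; destruct andb; [apply Rmax_l|lra]).
      assert (sstart b - x <= Rmax 0 (Rmin (sstart b) (dl j) - Rmax x (rel j))) by minmax.
      lra.
    + assert (HD' : send b <= D) by (rewrite Hb in H; minmax).
      eapply Rle_trans; [|apply proc_cons_le].
      apply IH; try easy; try lra. rewrite Hb in H. minmax.
Qed.

Definition interference (a : admission) (L : list admission) : R :=
  sumR (fun d => if excluded_middle_informative (amach d = amach a /\ atime d < aend a)
                 then asize d else 0) L.

Lemma proc_sched_suffix i A1 A2 j : 
  proc_by_deadline (sched i A2) j i <= proc_by_deadline (sched i (A1 ++ A2)) j i.
Proof.
  induction A1 as [|a A1 IH]; simpl; [lra|]. destruct Nat.eqb; [|easy].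
  eapply Rle_trans; [exact IH|apply proc_ins_le].
Qed.

Lemma proc_flat_map (f : nat -> schedule) l i j k : In i l ->
  proc_by_deadline (f i) j k <= proc_by_deadline (flat_map f l) j k.
Proof.
  induction l as [|i' l IH]; intros Hi; [easy|]. simpl flat_map. rewrite proc_app.
  assert (H1 := proc_nonneg (f i') j k). assert (H2 := proc_nonneg (flat_map f l) j k).
  destruct Hi as [->|Hi]; [lra|]. specialize (IH Hi). lra.
Qed.

(** The earlier admissions [A1] only fill gaps and take nothing away from [a]. Those in [L] occupy
    at most [amargin a] of its interval, so [asize a] units remain before [aend a], which is at most
    the deadline. *)
Lemma secured_completes m I A1 a L : valid_instance I -> run m I (A1 ++ a :: L) ->
  interference a L <= amargin a ->
  completes m (flat_map (fun i => sched i (A1 ++ a :: L)) (seq 0 m)) (ajob a) = true.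
Proof.
  intros HI Hr Hle.
  assert (Ha : In a (A1 ++ a :: L)) by (apply in_app_iff; right; now left).
  destruct (run_sound _ _ _ _ Hr Ha) as (H1 & H2 & H3 & H4 & H5).
  unfold completes. apply existsb_exists. exists (amach a).
  assert (Hin : In (amach a) (seq 0 m)) by (apply in_seq; lia).
  split; [easy|]. destruct H3 as [[x Hx] _]. rewrite Hx.
  assert (Hsz : asize a = x) by (unfold asize, size; now rewrite Hx).
  destruct Rle_dec as [|Hno]; [easy|]. exfalso. apply Hno. clear Hno.
  eapply Rle_trans; [|apply (proc_flat_map (fun i => sched i (A1 ++ a :: L)) _ (amach a) _ _ Hin)].
  eapply Rle_trans; [|apply proc_sched_suffix].
  assert (Ho : ordered (a :: L)).
  { assert (Ho := run_ordered _ _ _ Hr). clear -Ho. induction A1 as [|c A1 IH]; [easy|]. apply IH, Ho. }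
  assert (Hs : forall b, In b (a :: L) -> 0 < asize b).
  { intros b Hb. eapply asize_pos; [exact HI|exact Hr|]. apply in_app_iff. now right. }
  simpl. rewrite Nat.eqb_refl. rewrite <- Hsz.
  assert (Hs' : forall b, In b L -> 0 < asize b) by (intros; apply Hs; now right).
  apply (proc_ins (aend a)); try easy.
  - apply chain_sched; [apply Ho|]. intros b Hb. split; [auto|now apply Ho].
  - apply Hs; now left.
  - assert (H := busy_sched (aend a) (amach a) L (proj2 Ho) Hs').
    change (busy (aend a) (sched (amach a) L) <= interference a L) in H.
    unfold aend at 2. lra.
Qed.

Fixpoint harm_total (A : list admission) : R :=
  match A with
  | [] => 0
  | a :: L => sumR (fun d => harm a (amach d) (asize d) (atime d)) L + harm_total L
  end.

(** [harm_total] groups the charges by the harmed admission; this regroups them by the newcomer,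
    whose total harm the admission test bounds. *)
Lemma harm_total_snoc A d :
  harm_total (A ++ [d]) = harm_total A + sumR (fun a => harm a (amach d) (asize d) (atime d)) A.
Proof. induction A as [|a A IH]; simpl; [lra|]. rewrite IH, sumR_app. simpl. lra. Qed.

Lemma run_harm_total m I A : run m I A -> 2 * harm_total A <= sumR awt A.
Proof.
  induction 1 as [|A d Hr IH [(_ & _ & _ & _ & _ & _ & Hn) _]]; [simpl; lra|].
  rewrite harm_total_snoc, sumR_app. simpl. unfold awt at 2, asize. lra.
Qed.

Fixpoint secured (A : list admission) : R :=
  match A with
  | [] => 0
  | a :: L => (if Rle_dec (interference a L) (amargin a) then awt a else 0) + secured L
  end.

(** Subadditivity of [Rmin 1] on nonnegative reals: once the interfering sizes exceed the margin in
    total, the capped individual charges add up to the full weight. *)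
Lemma Rmin_sum {T} (f : T -> R) l s : 0 < s -> (forall x, In x l -> 0 <= f x) ->
  Rmin 1 (sumR f l / s) <= sumR (fun x => Rmin 1 (f x / s)) l.
Proof.
  intros Hs. induction l as [|x l IH]; intros Hf; simpl.
  - apply Rle_trans with (0 / s); [apply Rmin_r|]. unfold Rdiv; lra.
  - assert (H : Rmin 1 (sumR f l / s) <= sumR (fun x => Rmin 1 (f x / s)) l)
      by (apply IH; intros; apply Hf; now right).
    assert (0 <= f x / s) by (apply Rle_mult_inv_pos; [apply Hf; now left|easy]).
    assert (0 <= sumR f l / s)
      by (apply Rle_mult_inv_pos; [apply sumR_nonneg; intros; apply Hf; now right|easy]).
    rewrite Rdiv_plus_distr. minmax.
Qed.

Lemma insecure_harm a L : 0 < amargin a -> 0 <= awt a ->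
  (forall d, In d L -> 0 < asize d /\ atime a <= atime d) -> amargin a < interference a L ->
  awt a <= sumR (fun d => harm a (amach d) (asize d) (atime d)) L.
Proof.
  intros Hm Hw HL Hi.
  set (f := fun d => if excluded_middle_informative (amach d = amach a /\ atime d < aend a)
                     then asize d else 0).
  apply Rle_trans with (awt a * sumR (fun d => Rmin 1 (f d / amargin a)) L).
  - assert (H : Rmin 1 (sumR f L / amargin a) <= sumR (fun d => Rmin 1 (f d / amargin a)) L).
    { apply Rmin_sum; [easy|]. intros d Hd. unfold f.
      destruct excluded_middle_informative; [|lra]. apply Rlt_le, HL, Hd. }
    rewrite Rmin_left in H; [nra|].
    apply Rmult_le_reg_r with (amargin a); [easy|].
    unfold Rdiv. rewrite Rmult_assoc, Rinv_l by lra. change (interference a L) with (sumR f L) in Hi. lra.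
  - rewrite <- sumR_scal. apply sumR_le. intros d Hd. unfold f, harm.
    destruct (HL d Hd).
    destruct excluded_middle_informative as [H1|H1];
      destruct excluded_middle_informative as [H2|H2]; try lra.
    + exfalso. apply H2. split; [easy|]. split; [easy|]. apply H1.
    + exfalso. apply H1. split; [easy|apply H2].
    + unfold Rdiv. rewrite Rmult_0_l, Rmin_right; lra.
Qed.

Lemma weight_le_secured_harm A : ordered A ->
  (forall a, In a A -> 0 < asize a /\ 0 < amargin a /\ 0 <= awt a) ->
  sumR awt A <= secured A + harm_total A.
Proof.
  induction A as [|a A IH]; intros Ho H; simpl; [lra|].
  destruct Ho as [Ho1 Ho2].
  assert (sumR awt A <= secured A + harm_total A) by (apply IH; [easy|intros; apply H; now right]).
  destruct (H a (or_introl eq_refl)) as (Ha1 & Ha2 & Ha3).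
  assert (HL : forall d, In d A -> 0 < asize d /\ atime a <= atime d)
    by (intros d Hd; split; [apply H; now right|now apply Ho1]).
  destruct Rle_dec.
  - assert (0 <= sumR (fun d => harm a (amach d) (asize d) (atime d)) A); [|lra].
    apply sumR_nonneg. intros d Hd. unfold harm. destruct excluded_middle_informative; [|lra].
    apply Rmult_le_pos; [easy|]. apply Rmin_glb; [lra|].
    apply Rlt_le, Rdiv_lt_0_compat; [now apply HL|easy].
  - assert (awt a <= sumR (fun d => harm a (amach d) (asize d) (atime d)) A)
      by (apply insecure_harm; try easy; lra).
    lra.
Qed.

Lemma run_params_pos m I A a : valid_instance I -> run m I A -> In a A ->
  0 < asize a /\ 0 < amargin a /\ 0 <= awt a.
Proof.
  intros HI Hr Ha. assert (Hs := asize_pos _ _ _ _ HI Hr Ha).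
  destruct (run_sound _ _ _ _ Hr Ha) as (H1 & _ & H2 & _).
  repeat split; [easy|now apply margin_pos|]. apply Rlt_le, HI, H1.
Qed.

Lemma secured_le_throughput m I : valid_instance I ->
  secured (admissions m I (length I)) <= throughput m I (lifo m I).
Proof.
  intros HI. assert (Hr := admissions_run m I (length I)). unfold lifo.
  set (A := admissions m I (length I)) in *.
  set (S := flat_map (fun i => sched i A) (seq 0 m)).
  set (f := fun j => if completes m S j then wt j else 0).
  change (secured A <= sumR f I).
  apply Rle_trans with (sumR f (map ajob A)).
  - rewrite sumR_map.
    (* The induction runs over suffixes: [secured] looks only at later admissions, while completion
       refers to the schedule of the whole list. *)
    enough (H : forall A1 L, A = A1 ++ L -> secured L <= sumR (fun a => f (ajob a)) L)
      by (apply (H []); reflexivity).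
    intros A1 L; revert A1. induction L as [|a L IH]; intros A1 E; simpl; [lra|].
    assert (IH' := IH (A1 ++ [a]) ltac:(rewrite <- app_assoc; exact E)).
    enough ((if Rle_dec (interference a L) (amargin a) then awt a else 0) <= f (ajob a)) by lra.
    unfold f, S. destruct Rle_dec as [Hle|Hle].
    + rewrite E in *. rewrite secured_completes with (I := I); auto. unfold awt; lra.
    + destruct completes; [|lra]. apply Rlt_le, HI.
      eapply run_sound; [exact Hr|]. rewrite E. apply in_app_iff. right. now left.
  - apply sumR_incl.
    + eapply run_NoDup, Hr.
    + intros j Hj. apply in_map_iff in Hj. destruct Hj as [a [<- Ha]]. eapply run_sound; eauto.
    + intros j Hj. unfold f. destruct completes; [|lra]. apply Rlt_le, HI, Hj.
Qed.

Lemma admitted_weight_le m I : valid_instance I ->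
  sumR awt (admissions m I (length I)) <= 2 * throughput m I (lifo m I).
Proof.
  intros HI. assert (Hr := admissions_run m I (length I)).
  assert (H1 := secured_le_throughput m I HI).
  assert (H2 := run_harm_total _ _ _ Hr).
  assert (H3 := weight_le_secured_harm _ (run_ordered _ _ _ Hr) (fun a => run_params_pos _ _ _ a HI Hr)).
  lra.
Qed.

(** * Jobs that are never admitted *)

Definition overlap (x y u v : R) : R := Rmax 0 (Rmin y v - Rmax x u).

Lemma overlap_nonneg x y u v : 0 <= overlap x y u v.
Proof. apply Rmax_l. Qed.

Lemma overlap_split x y u p v : u <= p <= v -> overlap x y u v = overlap x y u p + overlap x y p v.
Proof. intros H. unfold overlap. minmax. Qed.

(* Induction on a list [P] of the breakpoints inside the window. *)
Lemma overlap_average {T} (c x y : T -> R) (A : list T) w (P : list R) :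
  (forall a, In a A -> 0 <= c a) ->
  forall u v, u <= v ->
  (forall a z, In a A -> (z = x a \/ z = y a) -> u < z < v -> In z P) ->
  (forall t, u <= t < v ->
     w <= sumR (fun a => if excluded_middle_informative (x a <= t < y a) then c a else 0) A) ->
  w * (v - u) <= sumR (fun a => c a * overlap (x a) (y a) u v) A.
Proof.
  intros Hc. induction P as [|p P IH]; intros u v Huv HP Hw.
  - destruct (Req_dec u v) as [<-|Hne].
    + rewrite Rminus_diag, Rmult_0_r. apply sumR_nonneg. intros a Ha.
      apply Rmult_le_pos; [auto|apply overlap_nonneg].
    + specialize (Hw u ltac:(lra)).
      apply Rle_trans with ((v - u) *
        sumR (fun a => if excluded_middle_informative (x a <= u < y a) then c a else 0) A); [nra|].
      rewrite <- sumR_scal. apply sumR_le. intros a Ha. specialize (Hc a Ha).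
      assert (Ho := overlap_nonneg (x a) (y a) u v).
      destruct excluded_middle_informative as [H|H]; [|nra].
      assert (v <= y a).
      { apply Rnot_lt_le. intros Hlt. apply (HP a (y a)); auto. lra. }
      replace (overlap (x a) (y a) u v) with (v - u); [lra|]. unfold overlap. minmax.
  - destruct (classic (u < p < v)) as [Hp|Hp].
    + rewrite (sumR_ext _ (fun a => c a * overlap (x a) (y a) u p + c a * overlap (x a) (y a) p v))
        by (intros a _; rewrite (overlap_split _ _ u p v) by lra; lra).
      rewrite sumR_plus. replace (w * (v - u)) with (w * (p - u) + w * (v - p)) by lra.
      apply Rplus_le_compat; apply IH; try lra;
        try (intros t Ht; apply Hw; lra); intros a z Ha Hz Hlt;
        (destruct (HP a z Ha Hz) as [E|E]; [lra|lra|easy]).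
    + apply IH; auto. intros a z Ha Hz Hlt.
      destruct (HP a z Ha Hz Hlt) as [E|E]; [subst; easy|easy].
Qed.

(* [pj, sj] are size and margin of a rejected job and [pa, sa] those of an admitted one. *)
Lemma overlap_kernel e pj sj pa sa x u tau :
  0 < e <= 1 -> 0 < pj -> 0 < pa -> e * pj <= 2 * sj -> 2 * sj <= pj ->
  e * pa <= 2 * sa -> 2 * sa <= pa -> u <= tau <= u + 2 * pj ->
  Rmin 1 (pj / sa) * overlap x (x + pa + sa) u (u + sj) <=
  68 / e * (pj * sj) * (pa / (pa * pa + (tau - x) * (tau - x))).
Proof.
  intros He Hpj Hpa Hj1 Hj2 Ha1 Ha2 Hu.
  set (Q := pa * pa + (tau - x) * (tau - x)).
  assert (Hpp : 0 < pa * pa) by now apply Rmult_lt_0_compat.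
  assert (HQ : 0 < Q) by (assert (Hsq := Rle_0_sqr (tau - x)); unfold Rsqr in Hsq; unfold Q; lra).
  assert (Hej : 0 < e * pj) by now apply Rmult_lt_0_compat.
  assert (Hea : 0 < e * pa) by now apply Rmult_lt_0_compat.
  assert (Hsj : 0 < sj) by lra. assert (Hsa : 0 < sa) by lra.
  assert (Hrhs : 0 < 68 / e * (pj * sj) * (pa / Q)).
  { repeat apply Rmult_lt_0_compat; try lra; try apply Rinv_0_lt_compat; lra. }
  assert (Ho := overlap_nonneg x (x + pa + sa) u (u + sj)).
  destruct (Req_dec (overlap x (x + pa + sa) u (u + sj)) 0) as [E|E]; [rewrite E; lra|].
  assert (Hx : x < u + sj /\ u < x + pa + sa) by (clear Hrhs; unfold overlap in *; minmax).
  assert (Hos : overlap x (x + pa + sa) u (u + sj) <= sj) by (unfold overlap; clear -Hsj; minmax).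
  assert (Hop : overlap x (x + pa + sa) u (u + sj) <= pa + sa) by (unfold overlap; clear -Hpa Hsa; minmax).
  set (o := overlap x (x + pa + sa) u (u + sj)) in *. clearbody o.
  assert (Hd : - (2 * pj + 2 * pa) <= tau - x <= 2 * pj + 2 * pa) by lra.
  assert (Hm1 : Rmin 1 (pj / sa) <= 1) by apply Rmin_l.
  assert (Hm2 : Rmin 1 (pj / sa) <= pj / sa) by apply Rmin_r.
  assert (Hd2 : (tau - x) * (tau - x) <= (2 * pj + 2 * pa) * (2 * pj + 2 * pa)) by nra.
  (* The larger of the two sizes bounds [|tau - x|] by four times itself, so [Q] is at most 17 times
     its square. For [pj <= pa] the charge is bounded by [pj / sa] and the overlap by [sj];
     otherwise they are bounded by 1 and [2 * pa]. The second case determines 68 = 4 * 17. *)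
  destruct (Rle_dec pj pa) as [Hle|Hle].
  - assert (HQ17 : Q <= 17 * (pa * pa)) by (unfold Q; nra).
    apply Rle_trans with (pj / sa * sj).
    { apply Rle_trans with (pj / sa * o); [now apply Rmult_le_compat_r|].
      apply Rmult_le_compat_l; [|easy]. apply Rlt_le, Rdiv_lt_0_compat; lra. }
    replace (pj / sa * sj) with (pj * sj * / sa) by (unfold Rdiv; ring).
    replace (68 / e * (pj * sj) * (pa / Q)) with (pj * sj * (68 / e * (pa / Q))) by (unfold Rdiv; ring).
    apply Rmult_le_compat_l; [nra|].
    apply Rle_trans with (2 / (e * pa)).
    + apply Rmult_le_reg_r with (sa * (e * pa)); [nra|].
      replace (/ sa * (sa * (e * pa))) with (e * pa) by (field; lra).
      replace (2 / (e * pa) * (sa * (e * pa))) with (2 * sa) by (field; lra). easy.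
    + apply Rmult_le_reg_r with (e * pa * Q); [nra|].
      replace (2 / (e * pa) * (e * pa * Q)) with (2 * Q) by (field; lra).
      replace (68 / e * (pa / Q) * (e * pa * Q)) with (68 * (pa * pa)) by (field; lra). nra.
  - assert (HQ17 : Q <= 17 * (pj * pj)) by (unfold Q; nra).
    apply Rle_trans with (2 * pa).
    { apply Rle_trans with (1 * o); [now apply Rmult_le_compat_r|]. lra. }
    apply Rmult_le_reg_r with (e * Q); [nra|].
    replace (68 / e * (pj * sj) * (pa / Q) * (e * Q)) with (68 * (pj * sj) * pa) by (field; lra).
    assert (e * Q <= 34 * (pj * sj)).
    { apply Rle_trans with (e * (17 * (pj * pj))); [nra|].
      replace (e * (17 * (pj * pj))) with (17 * pj * (e * pj)) by ring.
      replace (34 * (pj * sj)) with (17 * pj * (2 * sj)) by ring.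
      apply Rmult_le_compat_l; lra. }
    nra.
Qed.

(** A Cauchy kernel with centre [atime a] and scale [asize a]: the derivative of
    [atan ((tau - atime a) / asize a)] in [tau]. *)
Definition bump (a : admission) (tau : R) : R :=
  asize a / (asize a * asize a + (tau - atime a) * (tau - atime a)).

(** The harm test fails for [j] throughout its admission window. Averaging it over a subwindow of
    length [margin j i] turns every charge into an overlap, which [overlap_kernel] bounds by a bump
    at [tau]. *)
Lemma rejected_density m I e j i tau :
  valid_instance I -> 0 < e <= 1 ->
  (forall j i, In j I -> (i < m)%nat -> eligible j i -> e * size j i <= dl j - rel j - size j i) ->
  In j I -> ~ In j (map ajob (admissions m I (length I))) -> (i < m)%nat -> eligible j i ->
  rel j <= tau <= dl j ->
  wt j <= 136 / e * size j i *
    sumR (fun a => if Nat.eqb (amach a) i then awt a * bump a tau else 0) (admissions m I (length I)).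
Proof.
  intros HI He Hslack Hj Hn Hi Hel Htau.
  assert (Hr := admissions_run m I (length I)).
  assert (Hbl := fun t => admissions_blocked m I j i t HI Hj Hn Hi Hel).
  set (A := admissions m I (length I)) in *.
  assert (Hp := size_pos _ _ _ HI Hj Hel). assert (Hs := margin_pos _ _ Hp Hel).
  assert (Hs1 := margin_le j i). assert (Hs2 := margin_le_slack j i).
  assert (Hmargin : forall j i, In j I -> (i < m)%nat -> eligible j i -> e * size j i <= 2 * margin j i).
  { intros j0 i0 Hj0 Hi0 He0. specialize (Hslack j0 i0 Hj0 Hi0 He0).
    assert (Hp0 := size_pos _ _ _ HI Hj0 He0). unfold margin. assert (e * size j0 i0 <= size j0 i0) by nra.
    minmax. }
  set (p := size j i) in *. set (s := margin j i) in *.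
  (* The averaging window [[u, u + s)] starts at [tau], or earlier if it must be moved back to fit
     into the admission window. As [2 * s <= p], it stays within [2 * p] of [tau]. *)
  set (u := Rmin tau (dl j - p - 2 * s)).
  assert (Hu : rel j <= u /\ u <= dl j - p - 2 * s /\ u <= tau <= u + 2 * p) by (unfold u; minmax).
  set (c := fun a => if Nat.eqb (amach a) i then awt a * Rmin 1 (p / amargin a) else 0).
  assert (Hc : forall a, In a A -> 0 <= c a).
  { intros a Ha. destruct (run_params_pos _ _ _ _ HI Hr Ha) as (H1 & H2 & H3).
    unfold c. destruct Nat.eqb; [|lra]. apply Rmult_le_pos; [easy|].
    apply Rmin_glb; [lra|]. apply Rlt_le, Rdiv_lt_0_compat; lra. }
  assert (Havg : wt j / 2 * (u + s - u) <= sumR (fun a => c a * overlap (atime a) (aend a) u (u + s)) A).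
  { apply (overlap_average c atime aend A (wt j / 2) (map atime A ++ map aend A)); auto; try lra.
    - intros a z Ha [->| ->] _; apply in_app_iff; [left|right]; now apply in_map.
    - intros t Ht. specialize (Hbl t ltac:(lra)).
      erewrite sumR_ext; [apply (Rmult_le_reg_l 2); [lra|]; apply Rle_trans with (wt j); [lra|exact Hbl]|].
      intros a Ha. unfold c, harm.
      destruct (Nat.eqb_spec (amach a) i); destruct excluded_middle_informative;
        destruct excluded_middle_informative; tauto. }
  assert (Hker : sumR (fun a => c a * overlap (atime a) (aend a) u (u + s)) A <=
    sumR (fun a => 68 / e * (p * s) * (if Nat.eqb (amach a) i then awt a * bump a tau else 0)) A).
  { apply sumR_le. intros a Ha. unfold c.
    destruct (Nat.eqb_spec (amach a) i) as [E|E]; [|lra].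
    destruct (run_params_pos _ _ _ _ HI Hr Ha) as (H1 & H2 & H3).
    destruct (run_sound _ _ _ _ Hr Ha) as (K1 & K2 & K3 & _).
    assert (K := overlap_kernel e p s (asize a) (amargin a) (atime a) u tau He Hp H1
      (Hmargin _ _ Hj Hi Hel) Hs1 (Hmargin _ _ K1 K2 K3) (margin_le _ _) ltac:(lra)).
    unfold bump, aend.
    rewrite Rmult_assoc. replace (68 / e * (p * s) *
      (awt a * (asize a / (asize a * asize a + (tau - atime a) * (tau - atime a))))) with
      (awt a * (68 / e * (p * s) * (asize a / (asize a * asize a + (tau - atime a) * (tau - atime a)))))
      by ring.
    apply Rmult_le_compat_l; easy. }
  rewrite sumR_scal in Hker.
  set (W := sumR (fun a => if Nat.eqb (amach a) i then awt a * bump a tau else 0) A) in *.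
  (* The window length [s] cancels, and the factor 2 of the harm test doubles 68 to 136. *)
  apply Rmult_le_reg_r with (s / 2); [lra|].
  replace (136 / e * p * W * (s / 2)) with (68 / e * (p * s) * W) by (field; lra).
  replace (wt j * (s / 2)) with (wt j / 2 * (u + s - u)) by field. lra.
Qed.

(** * The arctangent potential *)

Definition potential (A : list admission) (i : nat) (tau : R) : R :=
  sumR (fun a => if Nat.eqb (amach a) i then awt a * atan ((tau - atime a) / asize a) else 0) A.

Lemma atan_bump a tau : 0 < asize a ->
  derivable_pt_lim (fun z => atan ((z - atime a) / asize a)) tau (bump a tau).
Proof.
  intros Hp.
  assert (H1 : derivable_pt_lim (fun z => (z - atime a) / asize a) tau (/ asize a)).
  { intros eps Heps. exists (mkposreal 1 Rlt_0_1). intros h Hh _.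
    replace (((tau + h - atime a) / asize a - (tau - atime a) / asize a) / h - / asize a) with 0
      by (field; lra).
    now rewrite Rabs_R0. }
  assert (H2 := derivable_pt_lim_comp _ atan tau _ _ H1 (derivable_pt_lim_atan _)).
  replace (bump a tau) with (/ (1 + ((tau - atime a) / asize a) ^ 2) * / asize a).
  - exact H2.
  - unfold bump. assert (Hsq := Rle_0_sqr (tau - atime a)). unfold Rsqr in Hsq.
    assert (0 < asize a * asize a) by now apply Rmult_lt_0_compat.
    field. repeat split; lra.
Qed.

Lemma potential_derivative A i tau : (forall a, In a A -> 0 < asize a) ->
  derivable_pt_lim (potential A i) tau
    (sumR (fun a => if Nat.eqb (amach a) i then awt a * bump a tau else 0) A).
Proof.
  intros HA. induction A as [|a A IH].
  - apply derivable_pt_lim_const.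
  - change (derivable_pt_lim (fun z =>
      (if Nat.eqb (amach a) i then awt a * atan ((z - atime a) / asize a) else 0) + potential A i z) tau
      ((if Nat.eqb (amach a) i then awt a * bump a tau else 0) +
       sumR (fun a => if Nat.eqb (amach a) i then awt a * bump a tau else 0) A)).
    apply (derivable_pt_lim_plus (fun z => if Nat.eqb (amach a) i then awt a * atan ((z - atime a) / asize a) else 0)).
    + destruct Nat.eqb; [|apply derivable_pt_lim_const].
      apply (derivable_pt_lim_scal (fun z => atan ((z - atime a) / asize a))).
      apply atan_bump, HA. now left.
    + apply IH. intros; apply HA; now right.
Qed.

Lemma atan_mono x y : x <= y -> atan x <= atan y.
Proof. intros [H|<-]; [apply Rlt_le, atan_increasing, H|lra]. Qed.

Lemma potential_mono A i s t : (forall a, In a A -> 0 < asize a /\ 0 <= awt a) -> s <= t ->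
  potential A i s <= potential A i t.
Proof.
  intros HA Hst. apply sumR_le. intros a Ha. destruct (HA a Ha) as [H1 H2].
  destruct Nat.eqb; [|lra]. apply Rmult_le_compat_l; [easy|]. apply atan_mono.
  apply Rmult_le_compat_r; [|lra]. apply Rlt_le, Rinv_0_lt_compat, H1.
Qed.

(* Split the remaining intervals at the first one: monotonicity of [H] bounds each side. *)
Lemma disjoint_increments (H : R -> R) (l : list segment) lo hi :
  (forall x y, x <= y -> H x <= H y) -> lo <= hi ->
  ForallOrdPairs disjoint_seg l ->
  (forall b, In b l -> sstart b < send b /\ lo <= H (sstart b) /\ H (send b) <= hi) ->
  sumR (fun b => H (send b) - H (sstart b)) l <= hi - lo.
Proof.
  intros Hm. remember (length l) as n eqn:En. assert (Hn : (length l <= n)%nat) by lia. clear En.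
  revert l lo hi Hn. induction n as [|n IH]; intros l lo hi Hn Hlh Hd Hb.
  - destruct l; simpl in *; [lra|lia].
  - destruct l as [|b l]; simpl; [lra|]. simpl in Hn.
    inversion Hd as [|? ? Hd1 Hd2]; subst. rewrite Forall_forall in Hd1.
    destruct (Hb b (or_introl eq_refl)) as (B1 & B2 & B3).
    assert (B4 := Hm (sstart b) (send b) ltac:(lra)).
    set (f := fun c : segment => if Rle_dec (send c) (sstart b) then true else false).
    assert (E : sumR (fun b => H (send b) - H (sstart b)) l =
      sumR (fun b => H (send b) - H (sstart b)) (filter f l) +
      sumR (fun b => H (send b) - H (sstart b)) (filter (fun c => negb (f c)) l)).
    { rewrite <- !sumR_filter, <- sumR_plus. apply sumR_ext. intros c _. destruct (f c); simpl; lra. }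
    assert (L1 : sumR (fun b => H (send b) - H (sstart b)) (filter f l) <= H (sstart b) - lo).
    { apply IH; [|lra|now apply pairs_filter|].
      - assert (Hl := filter_length_le f l). lia.
      - intros c Hc. apply filter_In in Hc. destruct Hc as [Hc1 Hc2]. unfold f in Hc2.
        destruct Rle_dec as [Hc3|]; [|easy].
        destruct (Hb c (or_intror Hc1)) as (C1 & C2 & C3). repeat split; auto. }
    assert (L2 : sumR (fun b => H (send b) - H (sstart b)) (filter (fun c => negb (f c)) l) <= hi - H (send b)).
    { apply IH; [|lra|now apply pairs_filter|].
      - assert (Hl := filter_length_le (fun c => negb (f c)) l). lia.
      - intros c Hc. apply filter_In in Hc. destruct Hc as [Hc1 Hc2]. unfold f in Hc2.
        destruct Rle_dec as [|Hc3]; [easy|].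
        destruct (Hb c (or_intror Hc1)) as (C1 & C2 & C3). repeat split; auto.
        destruct (Hd1 c Hc1); [auto|lra]. }
    lra.
Qed.

(** * Comparison with an arbitrary schedule *)

Definition gain (A : list admission) (b : segment) : R :=
  potential A (smach b) (send b) - potential A (smach b) (sstart b).

(** For a fixed admission, the segments of [S] on its machine are disjoint, so the increments of its
    arctangent add up to at most the range, of length [PI <= 4]. *)
Lemma total_gain m I S A : feasible_nm m I S ->
  (forall a, In a A -> 0 < asize a /\ 0 <= awt a) -> sumR (gain A) S <= 4 * sumR awt A.
Proof.
  intros (F1 & F2 & _ & _) HA.
  apply (pairs_of_nth same_machine_disjoint (Seg 0 0 0 0) S) in F2.
  rewrite (sumR_ext _ (fun b => sumR (fun a => if Nat.eqb (smach b) (amach a) then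
     awt a * (atan ((send b - atime a) / asize a) - atan ((sstart b - atime a) / asize a)) else 0) A)).
  2:{ intros b _. apply Rplus_eq_reg_r with (potential A (smach b) (sstart b)).
      transitivity (potential A (smach b) (send b)); [unfold gain; ring|].
      unfold potential. rewrite <- sumR_plus. apply sumR_ext. intros a _.
      rewrite (Nat.eqb_sym (smach b)). destruct Nat.eqb; lra. }
  rewrite sumR_swap, <- sumR_scal. apply sumR_le. intros a Ha. destruct (HA a Ha) as [H1 H2].
  rewrite (sumR_filter (fun b => Nat.eqb (smach b) (amach a))), sumR_scal.
  rewrite Rmult_comm. apply Rmult_le_compat_r; [easy|].
  assert (P4 := PI_4). assert (P0 := PI_RGT_0).
  apply Rle_trans with (PI / 2 - - (PI / 2)); [|lra].
  apply (disjoint_increments (fun z => atan ((z - atime a) / asize a))).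
  - intros x y Hxy. apply atan_mono. apply Rmult_le_compat_r; [|lra]. apply Rlt_le, Rinv_0_lt_compat, H1.
  - lra.
  - apply (pairs_filter _ (fun b => Nat.eqb (smach b) (amach a))) in F2.
    eapply pairs_impl; [|exact F2]. intros b c Hb Hc H. apply H.
    apply filter_In in Hb. apply filter_In in Hc. destruct Hb as [_ Hb], Hc as [_ Hc].
    apply Nat.eqb_eq in Hb, Hc. congruence.
  - intros b Hb. apply filter_In in Hb. destruct Hb as [Hb _]. split; [now apply F1|].
    assert (B1 := atan_bound ((sstart b - atime a) / asize a)).
    assert (B2 := atan_bound ((send b - atime a) / asize a)). lra.
Qed.

(** Completion means at least [size j i] units of processing, each worth the density of [j]. On
    every segment the mean value theorem writes the increment of the potential as length times
    derivative at an inner point, where [rejected_density] applies. *)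
Lemma rejected_weight m I S e j :
  valid_instance I -> 0 < e <= 1 ->
  (forall j i, In j I -> (i < m)%nat -> eligible j i -> e * size j i <= dl j - rel j - size j i) ->
  (forall j i x, In j I -> (i < m)%nat -> ptime j i = Some x -> eligible j i) ->
  feasible_nm m I S ->
  In j I -> ~ In j (map ajob (admissions m I (length I))) -> completes m S j = true ->
  wt j <= 136 / e *
    sumR (fun b => if Nat.eqb (sjob b) (jid j) then gain (admissions m I (length I)) b else 0) S.
Proof.
  intros HI He Hslack Hel (F1 & _) Hj Hn Hc.
  apply existsb_exists in Hc. destruct Hc as [i [Hi Hc]].
  apply in_seq in Hi. assert (Him : (i < m)%nat) by lia.
  destruct (ptime j i) as [x|] eqn:Ex; [|easy]. destruct Rle_dec as [Hx|]; [|easy]. clear Hc.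
  assert (Hij := Hel j i x Hj Him Ex).
  assert (Hp := size_pos _ _ _ HI Hj Hij).
  assert (Hsz : size j i = x) by (unfold size; now rewrite Ex).
  assert (Hden := fun tau => rejected_density m I e j i tau HI He Hslack Hj Hn Him Hij).
  assert (Hr := admissions_run m I (length I)).
  set (A := admissions m I (length I)) in *.
  assert (HA : forall a, In a A -> 0 < asize a /\ 0 <= awt a).
  { intros a Ha. destruct (run_params_pos _ _ _ _ HI Hr Ha) as (H1 & _ & H3). easy. }
  assert (Hw : 0 < wt j) by now apply HI.
  assert (H136 : 0 < 136 / e) by (apply Rdiv_lt_0_compat; lra).
  assert (Hmain : wt j * proc_by_deadline S j i <= size j i * (136 / e *
    sumR (fun b => if Nat.eqb (sjob b) (jid j) then gain A b else 0) S)).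
  { clear Hx. induction S as [|b S IH]; [unfold proc_by_deadline; simpl; lra|].
    rewrite proc_cons. simpl sumR. rewrite !Rmult_plus_distr_l.
    apply Rplus_le_compat; [|apply IH; intros; apply F1; now right].
    destruct (F1 b (or_introl eq_refl)) as (_ & Hb & _).
    assert (Hmono := potential_mono A (smach b)).
    assert (Hg : 0 <= gain A b) by (unfold gain; specialize (Hmono (sstart b) (send b) HA ltac:(lra)); lra).
    assert (H0 : 0 <= size j i * (136 / e * gain A b)).
    { apply Rmult_le_pos; [lra|]. apply Rmult_le_pos; lra. }
    destruct (Nat.eqb_spec (smach b) i) as [Em|Em]; destruct (Nat.eqb (sjob b) (jid j)); simpl; try lra.
    set (s' := Rmax (sstart b) (rel j)). set (e' := Rmin (send b) (dl j)).
    assert (Hs' : sstart b <= s' /\ rel j <= s') by (split; [apply Rmax_l|apply Rmax_r]).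
    assert (He' : e' <= send b /\ e' <= dl j) by (split; [apply Rmin_l|apply Rmin_r]).
    destruct (Rlt_dec s' e') as [Hlt|Hge]; [|rewrite Rmax_left by lra; lra].
    rewrite Rmax_right by lra.
    (* The density bound holds only within [[rel j, dl j]]; by monotonicity the clipped segment
       gains at most as much potential as the whole one. *)
    assert (M1 := Hmono (sstart b) s' HA ltac:(lra)).
    assert (M2 := Hmono e' (send b) HA ltac:(lra)).
    destruct (MVT_cor2 (potential A (smach b)) (fun tau =>
      sumR (fun a => if Nat.eqb (amach a) (smach b) then awt a * bump a tau else 0) A) s' e' Hlt)
      as [z [Hz1 Hz2]].
    { intros z _. apply potential_derivative. intros a Ha. now apply HA. }
    specialize (Hden z ltac:(lra)). rewrite Em in *.
    set (d := sumR _ A) in Hz1, Hden.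
    apply Rle_trans with (136 / e * size j i * d * (e' - s')); [apply Rmult_le_compat_r; lra|].
    replace (136 / e * size j i * d * (e' - s')) with (size j i * (136 / e * (d * (e' - s')))) by ring.
    rewrite <- Hz1. apply Rmult_le_compat_l; [lra|]. apply Rmult_le_compat_l; [lra|].
    unfold gain. rewrite Em. lra. }
  apply Rmult_le_reg_l with (size j i); [easy|].
  eapply Rle_trans; [|exact Hmain]. rewrite Rmult_comm. apply Rmult_le_compat_l; lra.
Qed.

(** Identifiers are distinct, so a segment pays for at most one job and its gain is spent only
    once. *)
Lemma sum_by_id (I : instance) (g : R) k : NoDup (map jid I) -> 0 <= g ->
  sumR (fun j => if Nat.eqb k (jid j) then g else 0) I <= g.
Proof.
  intros Hn Hg. induction I as [|j I IH]; simpl; [lra|].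
  simpl in Hn. apply NoDup_cons_iff in Hn. destruct Hn as [Hn1 Hn2]. specialize (IH Hn2).
  destruct (Nat.eqb_spec k (jid j)) as [->|_]; [|lra].
  rewrite (sumR_ext _ (fun _ => 0 * 0)); [rewrite sumR_scal; lra|].
  intros j' Hj'. destruct (Nat.eqb_spec (jid j) (jid j')) as [E|_]; [|lra].
  exfalso. apply Hn1. rewrite E. now apply in_map.
Qed.

Lemma throughput_le_admitted m I S e :
  valid_instance I -> 0 < e <= 1 ->
  (forall j i, In j I -> (i < m)%nat -> eligible j i -> e * size j i <= dl j - rel j - size j i) ->
  (forall j i x, In j I -> (i < m)%nat -> ptime j i = Some x -> eligible j i) ->
  feasible_nm m I S ->
  throughput m I S <= (1 + 544 / e) * sumR awt (admissions m I (length I)).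
Proof.
  intros HI He Hslack Hel HS.
  assert (Hrej := fun j => rejected_weight m I S e j HI He Hslack Hel HS).
  assert (Hr := admissions_run m I (length I)).
  set (A := admissions m I (length I)) in *.
  assert (HA : forall a, In a A -> 0 < asize a /\ 0 <= awt a).
  { intros a Ha. destruct (run_params_pos _ _ _ _ HI Hr Ha) as (H1 & _ & H3). easy. }
  assert (H136 : 0 < 136 / e) by (apply Rdiv_lt_0_compat; lra).
  assert (Hgain : forall b, In b S -> 0 <= gain A b).
  { intros b Hb. unfold gain.
    assert (H := potential_mono A (smach b) (sstart b) (send b) HA).
    assert (sstart b < send b) by now apply HS. lra. }
  set (adm := fun j => if excluded_middle_informative (In j (map ajob A)) then true else false).
  set (g := fun j => 136 / e * sumR (fun b => if Nat.eqb (sjob b) (jid j) then gain A b else 0) S).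
  assert (H1 : throughput m I S <= sumR (fun j => (if adm j then wt j else 0) + g j) I).
  { apply (sumR_le (fun j => if completes m S j then wt j else 0)). intros j Hj.
    assert (Hw : 0 < wt j) by now apply HI.
    assert (Hg : 0 <= g j).
    { apply Rmult_le_pos; [lra|]. apply sumR_nonneg. intros b Hb. destruct Nat.eqb; [auto|lra]. }
    unfold adm. destruct excluded_middle_informative as [Hin|Hin].
    - destruct completes; lra.
    - destruct (completes m S j) eqn:Ec; [|lra]. specialize (Hrej j Hj Hin Ec). unfold g. lra. }
  rewrite sumR_plus, sumR_filter in H1.
  assert (H2 : sumR wt (filter adm I) <= sumR awt A).
  { change (sumR wt (filter adm I) <= sumR (fun a => wt (ajob a)) A). rewrite <- (sumR_map ajob wt).
    apply sumR_incl.
    - apply NoDup_filter. now apply NoDup_instance.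
    - intros j Hj. apply filter_In in Hj. destruct Hj as [_ Hj]. unfold adm in Hj.
      now destruct excluded_middle_informative.
    - intros j Hj. apply in_map_iff in Hj. destruct Hj as [a [<- Ha]]. now apply HA. }
  assert (H3 : sumR g I <= 136 / e * (4 * sumR awt A)).
  { unfold g. rewrite sumR_scal. apply Rmult_le_compat_l; [lra|].
    rewrite sumR_swap. eapply Rle_trans; [|eapply total_gain; eauto].
    apply sumR_le. intros b Hb. apply sum_by_id; [apply HI|auto]. }
  replace ((1 + 544 / e) * sumR awt A) with (sumR awt A + 136 / e * (4 * sumR awt A)) by (field; lra).
  lra.
Qed.

Theorem theorem1 :
  exists (C : R) (A : algorithm), 0 < C /\ online A /\
    forall (m : nat) (eps : R) (I : instance),
      0 < eps -> valid_instance I -> has_slack m eps I ->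
      feasible_nm m I (A m I) /\
      forall S : schedule, feasible_nm m I S ->
        throughput m I S <= C * Rmax 1 (1 / eps) * throughput m I (A m I).
Proof.
  exists 1090, lifo. split; [lra|]. split; [apply lifo_online|].
  intros m eps I Heps HI Hsl. split; [now apply lifo_feasible|]. intros S HS.
  set (M := Rmax 1 (1 / eps)).
  assert (HM : 1 <= M) by apply Rmax_l.
  assert (HM' : 1 / eps <= M) by apply Rmax_r.
  (* [/ M] is the minimum of 1 and [eps]; it serves as the slack parameter [e] of the analysis. *)
  assert (He : 0 < / M <= 1).
  { split; [apply Rinv_0_lt_compat; lra|]. rewrite <- Rinv_1. apply Rinv_le_contravar; lra. }
  assert (Hle : / M <= eps).
  { replace eps with (/ (1 / eps)) by (field; lra). apply Rinv_le_contravar; [|easy].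
    apply Rdiv_lt_0_compat; lra. }
  assert (H1 : throughput m I S <= (1 + 544 / / M) * sumR awt (admissions m I (length I))).
  { apply throughput_le_admitted; auto.
    - intros j i Hj Hi Hel. assert (Hp := size_pos _ _ _ HI Hj Hel).
      destruct Hel as [[x Hx] _]. unfold size in *. rewrite Hx in *.
      specialize (Hsl j i x Hj Hi Hx). nra.
    - intros j i x Hj Hi Hx. split; [eauto|]. unfold size. rewrite Hx.
      assert (0 < x) by (eapply HI; eauto).
      specialize (Hsl j i x Hj Hi Hx). nra. }
  replace (544 / / M) with (544 * M) in H1 by (field; lra).
  assert (H2 := admitted_weight_le m I HI).
  assert (H3 : 0 <= sumR awt (admissions m I (length I))).
  { apply sumR_nonneg. intros a Ha.
    eapply run_params_pos; [exact HI|apply admissions_run|exact Ha]. }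
  nra.
Qed.
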